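(* Let $G$ be an embedded planar graph and $\mathcal P$ a family of pairwise uncrossed paths in $G$ such that every edge of $G$ lies on at most $k$ paths of $\mathcal P$, and let $U$ be the edge-intersection graph of $\mathcal P$. Then $\chi(U)=O(k^2\log|E(U)|)$.
   Context: The edge-intersection graph $U$ of $\mathcal P$ has vertex set $\mathcal P$, with $P,P'$ adjacent when they are distinct and share an edge of $G$; $\chi$ denotes chromatic number. Two paths $P,Q$ of the embedded graph cross if there is a maximal common subpath $Z$ (possibly a single node) containing no endpoint of $P$ or $Q$ such that, writing $P=P_1,e,Z,e',P_2$ and $Q=Q_1,g,Z,g',Q_2$, the edges $e,g,e',g'$ alternate between $P$ and $Q$ in the clockwise order around $Z$; otherwise they are uncrossed. *)

(* Defs.v *)
From mathcomp Require Import ssreflect ssrfun ssrbool eqtype ssrnat seq path.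
From mathcomp Require Import choice fintype finfun finset fingraph div prime bigop.

Set Implicit Arguments.
Unset Strict Implicit.
Unset Printing Implicit Defensive.

(* Embedded (plane) graphs as combinatorial maps / rotation systems.        *)
(*   V     : vertices (a finType; isolated vertices allowed)                *)
(*   D     : darts (= oriented edges); each edge {d, opp d} has two darts   *)
(*   tail  : the vertex a dart leaves                                       *)
(*   opp   : the reversal of a dart (fixed-point-free involution)           *)
(*   rot   : the clockwise successor of a dart around its tail vertex       *)
(* Planarity = the rotation system has genus 0 on every component, i.e.     *)
(* Euler's formula  #vertex-orbits - #edges + #faces = 2 * #components     *)
(* (counted on the darts), written without subtraction.                     *)

Section Embedded.
Variables (V D : finType) (tail : D -> V) (opp rot : D -> D).

Definition dhead (d : D) : V := tail (opp d).

Definition face (d : D) : D := rot (opp d).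

Definition dart_rel : rel D := fun d d' => (d' == opp d) || (d' == rot d).

Definition plane_embedding : Prop :=
  involutive opp /\
  (forall d, tail (opp d) != tail d) /\
  (forall d d', tail d = tail d' -> dhead d = dhead d' -> d = d') /\
  injective rot /\
  (forall d, tail (rot d) = tail d) /\
  (forall d d', tail d = tail d' -> fconnect rot d d') /\
  2 * (fcard rot (predT : {pred D}) + fcard face (predT : {pred D}))
    = #|D| + 4 * n_comp dart_rel (predT : {pred D}).

(* A path: a start vertex together with the sequence of its darts. *)
Definition gpath : Type := (V * seq D)%type.

Fixpoint walk_from (v : V) (s : seq D) : bool :=
  if s is d :: s' then (tail d == v) && walk_from (dhead d) s' else true.

Definition pverts (p : gpath) : seq V := p.1 :: map dhead p.2.

Definition is_gpath (p : gpath) : bool := walk_from p.1 p.2 && uniq (pverts p).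

Definition plast (p : gpath) : V := last p.1 (map dhead p.2).

Definition prev (p : gpath) : gpath := (plast p, rev (map opp p.2)).

Definition edge_on (d : D) (p : gpath) : bool := (d \in p.2) || (opp d \in p.2).

Definition subpath (Z p : gpath) : bool :=
  [&& is_gpath Z, Z.1 \in pverts p & infix Z.2 p.2 || infix (prev Z).2 p.2].

Definition max_common (Z p q : gpath) : Prop :=
  (subpath Z p && subpath Z q) /\
  forall Z' : gpath, subpath Z' p -> subpath Z' q -> subpath Z Z' ->
    size Z'.2 <= size Z.2.

Definition no_endpoint (Z p : gpath) : bool :=
  (p.1 \notin pverts Z) && (plast p \notin pverts Z).

(* darts strictly after x and strictly before y, clockwise around tail x
   (all darts at tail x except x when y = x) *)
Definition arc (x y : D) : seq D :=
  take (findex rot (rot x) y) (orbit rot (rot x)).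

(* Clockwise cyclic sequence of darts leaving the subpath with dart sequence
   z, i.e. the rotation at the vertex obtained by contracting z; for a single
   vertex (z = [::]) it is the rotation at the tail of d0. *)
Definition ring (z : seq D) (d0 : D) : seq D :=
  match z with
  | [::] => orbit rot d0
  | f0 :: _ =>
      let fl := last f0 z in
      let prs := zip z (behead z) in
      arc f0 f0
      ++ flatten [seq arc (opp pr.1) pr.2 | pr <- prs]
      ++ arc (opp fl) (opp fl)
      ++ flatten (rev [seq arc pr.2 (opp pr.1) | pr <- prs])
  end.

(* a, b separate c, d in the cyclic sequence s *)
Definition alternate (s : seq D) (a b c d : D) : bool :=
  let i x := index x s in
  let lo := minn (i a) (i b) in
  let hi := maxn (i a) (i b) in
  let inside x := (lo < i x) && (i x < hi) in
  [&& a \in s, b \in s, c \in s, d \in s & inside c != inside d].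

Definition crosses (p q : gpath) : Prop :=
  exists Z : gpath,
    [/\ max_common Z p q, no_endpoint Z p, no_endpoint Z q &
      exists (a : seq D) (e e' : D) (b a' : seq D) (g g' : D) (b' : seq D),
        [/\ p.2 = a ++ e :: Z.2 ++ e' :: b,
            q.2 = a' ++ g :: Z.2 ++ g' :: b' \/
              (prev q).2 = a' ++ g :: Z.2 ++ g' :: b',
            dhead e = Z.1, dhead g = Z.1 &
            alternate (ring Z.2 e') (opp e) e' (opp g) g'] ].

Definition uncrossed (p q : gpath) : Prop := ~ crosses p q.

Definition adjU (n : nat) (P : 'I_n -> gpath) : rel 'I_n :=
  fun i j => (i != j) && [exists d : D, edge_on d (P i) && edge_on d (P j)].

End Embedded.

Section Coloring.
Variable T : finType.

Definition colorableb (adj : rel T) (m : nat) : bool :=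
  [exists f : {ffun T -> 'I_m},
     [forall x, [forall y, adj x y ==> (f x != f y)]]].

Definition chi (adj : rel T) : nat := find (colorableb adj) (iota 0 #|T|.+1).

End Coloring.

Definition nedges (n : nat) (adj : rel 'I_n) : nat :=
  #|[set p : 'I_n * 'I_n | (p.1 < p.2) && adj p.1 p.2]|.

(* Main.v *)
From mathcomp Require Import ssreflect ssrfun ssrbool eqtype ssrnat seq path.
From mathcomp Require Import choice fintype finfun finset fingraph prime bigop.
From mathcomp Require Import fingroup perm zify.
Require Import Defs.

Set Implicit Arguments.
Unset Strict Implicit.
Unset Printing Implicit Defensive.

(** The graph [U] is in fact [O(k)]-degenerate.

    Sample each path with probability about [1/(10k)] and keep those whose two
    end edges meet no other sampled path.  A fixed pair of paths sharing an edge
    [e] away from their end edges survives, as the only two users of [e], with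
    probability at least [c/k^2], so it is enough to show that [n] paths with
    private end edges have [O(n)] pairs that are alone on some edge.

    For such a family any two paths through a dart part at both ends of their
    common subpath; being uncrossed, they have the same left-to-right order at
    both ends.  So the paths through each dart are linearly ordered, compatibly
    along edges, and every edge can be replaced by parallel copies, one for each
    path.  On the resulting darts let [al] reverse a copy, [pi] pass to the
    other dart of the same path at the same vertex, and [sg] be the rotation.
    The paths are the cycles of [al * pi]; the contacts are swapped by an
    involution [eps]; hence [psi = eps * al * pi] is the face permutation of the
    contact graph.  As [psi = (eps * al * sg) * (pi * sg)^-1] and the number of
    transpositions needed to write a permutation is subadditive, [psi] has many
    cycles as soon as [eps * al * sg] (digons and faces of the original map,
    counted by Euler's formula) and [pi * sg] (regions cut out by the
    noncrossing chords of the paths at the vertices) do.  But almost every cycle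
    of [psi] meets at least three contacts, which bounds the number of
    contacts. *)

(** * Cycle counts of permutations *)

Section Cycles.
Variable T : finType.
Implicit Types s t : {perm T}.

(** On [S] the map [f] factors through [h]. The factor [g] chooses a preimage and takes values in
    [option A], which supplies a value where there is none. *)
Lemma leq_card_imset_factor (A B : finType) (f : T -> A) (h : T -> B)
    (S : {set T}) :
  {in S &, forall x y, h x = h y -> f x = f y} -> #|f @: S| <= #|h @: S|.
Proof.
move=> hf.
pose g v := omap f [pick x in S | h x == v].
have sub : Some @: (f @: S) \subset g @: (h @: S).
  apply/subsetP=> _ /imsetP[_ /imsetP[x xS ->] ->].
  apply/imsetP; exists (h x); first exact: imset_f.
  rewrite /g; case: pickP => [y /andP[yS /eqP hy]|/(_ x)] /=.
    by congr Some; apply: hf.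
  by rewrite xS eqxx.
rewrite -(card_imset (f @: S) (f := @Some A)); last by move=> ? ? [].
exact: leq_trans (subset_leq_card sub) (leq_imset_card _ _).
Qed.

Lemma porbit_invariant (A : eqType) (f : T -> A) s :
  (forall x, f (s x) = f x) -> forall x y, x \in porbit s y -> f x = f y.
Proof.
move=> fs x y /porbitP[i ->]; rewrite permX.
by elim: i => //= i <-; rewrite fs.
Qed.

Lemma porbit_step s x : porbit s (s x) = porbit s x.
Proof. exact: (porbit_perm s 1 x). Qed.

Definition ncyc s : nat := #|porbits s|.

(** An invariant factors through the cycles. Lower bounds on cycle counts come from exhibiting
    invariants with many values. *)
Lemma leq_card_invariant (A : finType) (f : T -> A) s :
  (forall x, f (s x) = f x) -> #|f @: [set: T]| <= ncyc s.
Proof.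
move=> fs; rewrite /ncyc /porbits.
have -> : porbit s @: T = porbit s @: [set: T].
  by apply/setP=> O; apply/imsetP/imsetP=> -[x _ ->]; exists x.
apply: leq_card_imset_factor => x y _ _ /eqP.
rewrite eq_porbit_mem; exact: porbit_invariant.
Qed.

Lemma ncyc1 : ncyc (1%g : {perm T}) = #|T|.
Proof.
rewrite /ncyc card_imset // => x y /eqP; rewrite eq_porbit_mem => /porbitP[i ->].
by rewrite expg1n perm1.
Qed.

Lemma leq_ncyc s : ncyc s <= #|T|.
Proof. exact: leq_imset_card. Qed.

(** A transposition of two points of one cycle splits it; of two different cycles, as in
    [ncyc_tperm_diff], joins them. *)
Lemma ncyc_tperm_same s x y :
  x != y -> y \in porbit s x -> ncyc (tperm x y * s)%g = (ncyc s).+1.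
Proof.
move=> nxy yx; have := porbits_mul_tperm s x y.
by rewrite /= porbit_sym yx nxy addn0 addn1.
Qed.

Lemma ncyc_tperm_diff s x y :
  y \notin porbit s x -> ncyc s = (ncyc (tperm x y * s)%g).+1.
Proof.
move=> yx; have := porbits_mul_tperm s x y.
have nxy : x != y by apply: contraNneq yx => ->; apply: porbit_id.
rewrite /= porbit_sym yx nxy addn2 addn1.
by case.
Qed.

Lemma ncyc_tperm_ge s x y : ncyc s <= (ncyc (tperm x y * s)%g).+1.
Proof.
have [->|nxy] := eqVneq x y; first by rewrite tperm1 mul1g.
have [/(ncyc_tperm_same nxy) ->|/ncyc_tperm_diff ->] := boolP (y \in porbit s x).
  lia.
exact: leqnn.
Qed.

(* The length [#|T| - ncyc s] is the least number of transpositions with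
   product [s], hence subadditive. *)
Lemma ncycM_ge s t : ncyc s + ncyc t <= #|T| + ncyc (s * t)%g.
Proof.
have [n] := ubnP (#|T| - ncyc s); elim: n s => // n IHn s lt_n.
have [s1|] := boolP [forall x, s x == x].
  have -> : s = 1%g by apply/permP=> x; rewrite perm1; apply/eqP/(forallP s1).
  by rewrite mul1g ncyc1.
case/forallPn=> x sx.
have xsx : s x \in porbit s x by rewrite (mem_porbit s 1).
have nsx : x != s x by rewrite eq_sym.
(* Splitting off [x] makes [s'] one transposition shorter than [s], so the induction applies to it;
   putting the transposition back in front of [s' * t] loses at most one cycle. *)
have cs' := ncyc_tperm_same nsx xsx; set s' := (_ * s)%g in cs'.
have lt0 : ncyc s < #|T| by rewrite -cs' leq_ncyc.
have := IHn s'; rewrite cs' => /(_ ltac:(lia)).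
have := ncyc_tperm_ge (s' * t)%g x (s x).
have -> : (tperm x (s x) * (s' * t) = s * t)%g.
  by rewrite /s' !mulgA tperm2 mul1g.
lia.
Qed.

Lemma ncyc_div_ge s t : ncyc s + ncyc t <= #|T| + ncyc (s * t^-1)%g.
Proof.
have -> : ncyc t = ncyc t^-1 by rewrite /ncyc porbitsV.
exact: ncycM_ge.
Qed.

Lemma porbit_fconnect s x y : (y \in porbit s x) = fconnect s x y.
Proof.
apply/porbitP/idP => [[i ->]|]; first by rewrite permX fconnect_iter.
by move/iter_findex=> <-; exists (findex s x y); rewrite permX.
Qed.

Lemma fcard_ncyc s : fcard s (predT : {pred T}) = ncyc s.
Proof.
have sy := fconnect_sym (@perm_inj _ s).
rewrite /n_comp_mem /ncyc /porbits.
have -> : porbit s @: T = porbit s @: [set x | froots s x].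
  apply/setP=> O; apply/imsetP/imsetP => [[x _ ->]|[x _ ->]]; last by exists x.
  exists (froot s x); first by rewrite inE; apply: roots_root.
  by apply/eqP; rewrite eq_porbit_mem porbit_fconnect sy connect_root.
rewrite card_in_imset; last first.
  move=> x y; rewrite !inE => /eqP rx /eqP ry /eqP.
  rewrite eq_porbit_mem porbit_fconnect => /(rootP sy).
  by rewrite rx ry.
by apply: eq_card => x; rewrite !inE andbT.
Qed.

(** Every cycle inside [A] accounts for two units on the left: two points, or one point that is
    counted again as a fixed point. *)
Lemma leq_card_involution s (A : {set T}) :
  (forall x, x \in A -> s x \in A) -> (forall x, x \in A -> s (s x) = x) ->
  #|A| + #|[set x in A | s x == x]| <= 2 * #|porbit s @: A|.
Proof.
move=> sA ssA.
have orbA x : x \in A -> porbit s x = [set x; s x].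
  move=> xA; apply/setP=> y; rewrite !inE; apply/porbitP/orP => [[i ->]|].
    rewrite permX; elim: i => [|i]; first by left.
    by rewrite iterS => -[] /eqP ->; [right | left; rewrite ssA].
  by case=> /eqP ->; [exists 0; rewrite expg0 perm1 | exists 1].
rewrite -sum1dep_card big_mkcondr /= -sum1_card -big_split /=.
rewrite (partition_big_imset (porbit s)) /= mulnC -sum_nat_const.
apply: leq_sum => _ /imsetP[x xA ->].
rewrite (eq_bigl (fun y => y \in [set x; s x])); last first.
  move=> y; apply/andP/idP => [[yA /eqP e]|]; first
    by rewrite -orbA // -e porbit_id.
  move=> yx; split; last by rewrite eq_porbit_mem orbA.
  by move: yx; rewrite !inE => /orP[] /eqP -> //; apply: sA.
have [e|nx] := eqVneq (s x) x.
  by rewrite e setUid big_set1 e eqxx.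
by rewrite big_setU1 ?inE ?big_set1 1?eq_sym //= ssA // eq_sym (negPf nx).
Qed.

End Cycles.

(** * Deleting edges from a plane map *)

Section Components.
Variable T : finType.

Lemma connect_invariant (A : eqType) (f : T -> A) (e : rel T) :
  (forall x y, e x y -> f x = f y) -> forall x y, connect e x y -> f x = f y.
Proof.
move=> fe x y /connectP[p ep ->].
by elim: p x ep => //= z p IHp x /andP[/fe -> /IHp].
Qed.

(** On a finite type, a step of an injection is undone by iterating the same injection. *)
Lemma connect_sym_perms (a b : T -> T) :
  injective a -> injective b ->
  connect_sym (fun x y => (y == a x) || (y == b x)).
Proof.
move=> a_inj b_inj; set e := (fun _ _ => _).
suff back x y : connect e x y -> connect e y x.
  by move=> x y; apply/idP/idP; apply: back.
case/connectP=> p ep ->; elim: p x ep => //= z p IHp x /andP[exz /IHp zx].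
apply: connect_trans zx _.
have iterc (g : T -> T) n w : (forall u, e u (g u)) -> connect e w (iter n g w).
  move=> eg; elim: n => [|n IHn] /=; first exact: connect0.
  exact: connect_trans IHn (connect1 (eg _)).
have backf (g : T -> T) : injective g -> (forall u, e u (g u)) -> connect e (g x) x.
  move=> g_inj eg; have := iter_order g_inj x.
  by rewrite -orderSpred iterSr => {2}<-; apply: iterc.
by case/orP: exz => /eqP ->; apply: backf => // u; rewrite /e eqxx ?orbT.
Qed.

Lemma n_comp_roots (e : rel T) : n_comp e (predT : {pred T}) = #|[set x | roots e x]|.
Proof. by rewrite /n_comp_mem cardsE; apply: eq_card => x; rewrite !inE andbT. Qed.

(** Redirecting the component of [y] to that of [x] gives a map [f] that is constant on
    [e']-components. So the [e]-roots other than that of [y] inject into the [e']-roots, and all of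
    them do when [x] and [y] are already connected. *)
Lemma leq_n_comp_merge (e e' : rel T) x y :
  connect_sym e -> connect_sym e' ->
  (forall u v, e' u v -> connect e u v \/ (u = x /\ v = y) \/ (u = y /\ v = x)) ->
  n_comp e (predT : {pred T}) <=
    n_comp e' (predT : {pred T}) + ~~ connect e x y.
Proof.
move=> se se' ee'; rewrite !n_comp_roots.
pose f u := if root e u == root e y then root e x else root e u.
have fe' u v : e' u v -> f u = f v.
  case/ee' => [/(rootP se) uv|[[-> ->]|[-> ->]]]; rewrite /f ?uv // eqxx;
    by case: eqP.
have inj : {in [set u | roots e u] :\ root e y &, injective (root e')}.
  move=> u v; rewrite !inE => /andP[nu /eqP ru] /andP[nv /eqP rv] /(rootP se').
  by move/(connect_invariant fe'); rewrite /f ru rv (negPf nu) (negPf nv).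
have sub : root e' @: ([set u | roots e u] :\ root e y) \subset [set u | roots e' u].
  by apply/subsetP => _ /imsetP[u _ ->]; rewrite inE roots_root.
have := subset_leq_card sub; rewrite card_in_imset //.
have [cxy|ncxy] := boolP (connect e x y); last first.
  rewrite [#|[set u | roots e u]|](cardsD1 (root e y)) inE roots_root //=.
  by rewrite addnC leq_add2r.
rewrite addn0 => _.
have inj2 : {in [set u | roots e u] &, injective (root e')}.
  have fr u : f u = root e u by rewrite /f (rootP se cxy); case: eqP.
  move=> u v; rewrite !inE => /eqP ru /eqP rv /(rootP se').
  by move/(connect_invariant fe'); rewrite !fr ru rv.
rewrite -(card_in_imset inj2); apply: subset_leq_card.
by apply/subsetP => _ /imsetP[u _ ->]; rewrite inE roots_root.
Qed.

End Components.

Section Deletion.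
Variables (D : finType) (opp rot : D -> D).
Hypothesis oppK : involutive opp.
Hypothesis opp_neq : forall d, opp d != d.
Hypothesis rot_inj : injective rot.

(** Edges are deleted without changing the type of darts: a deleted dart becomes a fixed point of
    the reversal, and the face walk slides over it by [rot]. *)
Definition keep (A : {set D}) (d : D) : D :=
  if (d \in A) || (opp d \in A) then d else opp d.

Lemma keepK A : involutive (keep A).
Proof.
move=> d; rewrite /keep; case E: ((d \in A) || _); rewrite ?E //.
by rewrite oppK orbC E.
Qed.

Definition rotp : {perm D} := perm rot_inj.
Definition keepp A : {perm D} := perm (inv_inj (keepK A)).
Definition facep A : {perm D} := (keepp A * rotp)%g.

Lemma facepE A d : facep A d = rot (keep A d).
Proof. by rewrite permM !permE. Qed.

Definition ncomp_keep A : nat :=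
  n_comp (fun d d' => (d' == keep A d) || (d' == rot d)) (predT : {pred D}).

Lemma facep_del (A : {set D}) d :
  d \in A -> opp d \in A ->
  facep A = (tperm d (opp d) * facep (A :\ d :\ opp d))%g.
Proof.
move=> dA odA; apply/permP => x; rewrite permM !facepE; congr (rot _).
have nd := opp_neq d.
rewrite permE /= /keep.
case: (eqVneq x d) => [->|xd].
  by rewrite dA !inE oppK !eqxx /= ?andbF.
case: (eqVneq x (opp d)) => [->|xod].
  by rewrite odA !inE !eqxx /= ?andbF.
rewrite !inE xd xod /=.
have -> : opp x != d by apply: contraNneq xod => <-; rewrite oppK.
by have -> : opp x != opp d by rewrite (inj_eq (inv_inj oppK)).
Qed.

(* Deleting an edge splits or merges cycles of the face permutation; a component
   can fall apart only in the first case. *)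
Lemma euler_delete (A : {set D}) :
  (forall d, (opp d \in A) = (d \in A)) ->
  2 * (ncyc rotp + ncyc (facep set0)) = #|D| + 4 * ncomp_keep set0 ->
  #|D| + 4 * ncomp_keep A <= 2 * (ncyc rotp + ncyc (facep A)) + #|A|.
Proof.
move=> cA eul; have [n] := ubnP #|A|; elim: n A cA => // n IHn A cA ltA.
have [->|[d dA]] := set_0Vmem A; first by rewrite eul cards0; lia.
have odA : opp d \in A by rewrite cA.
pose A' := A :\ d :\ opp d.
have cA' x : (opp x \in A') = (x \in A').
  rewrite !inE cA (inj_eq (inv_inj oppK)).
  rewrite (can2_eq oppK oppK) andbCA; congr (_ && _).
have cardA : #|A| = #|A'|.+2.
  rewrite (cardsD1 d) dA (cardsD1 (opp d) (A :\ d)) !inE odA opp_neq /=.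
  by rewrite /A' !add1n.
have ltA' : #|A'| < n by lia.
have {IHn} IH := IHn A' cA' ltA'.
have sym B : connect_sym (fun d d' => (d' == keep B d) || (d' == rot d)).
  exact: connect_sym_perms (inv_inj (keepK B)) rot_inj.
have eqs := facep_del dA odA; rewrite -/A' in eqs.
have merge : ncomp_keep A <= ncomp_keep A' +
    ~~ connect (fun d d' => (d' == keep A d) || (d' == rot d)) d (opp d).
  apply: leq_n_comp_merge (sym A) (sym A') _ => u v /orP[]/eqP ->; last first.
    by left; apply: connect1; rewrite eqxx orbT.
  have nd := opp_neq d; rewrite /keep !inE.
  case: (eqVneq u d) => [->|ud].
    by rewrite !eqxx /= ?andbF /=; right; left.
  case: (eqVneq u (opp d)) => [->|uod].
    by rewrite oppK !eqxx /= ?andbF /=; right; right.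
  have -> : opp u != d by apply: contraNneq uod => <-; rewrite oppK.
  have -> : opp u != opp d by rewrite (inj_eq (inv_inj oppK)).
  by left; apply: connect1; rewrite /keep eqxx.
have nd : d != opp d by rewrite eq_sym opp_neq.
(* If both sides of the edge are on one face cycle, deletion gains a cycle and adds two to [#|A|]:
   this gives the four units needed for a possible new component. *)
have [same|diff] := boolP (opp d \in porbit (facep A') d).
  have := ncyc_tperm_same nd same; rewrite -eqs => ->.
  by move: merge; case: (~~ _); rewrite cardA; lia.
have e1 := ncyc_tperm_diff diff; rewrite -eqs in e1.
(* Otherwise the two face cycles are joined, and following the joined cycle connects [d] to [opp d]
   without the deleted edge. The lost cycle is balanced by the growth of [#|A|]. *)
suff conn : connect (fun d d' => (d' == keep A d) || (d' == rot d)) d (opp d).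
  by move: merge; rewrite conn cardA; lia.
have : opp d \in porbit (facep A) d.
  apply: contraT => /ncyc_tperm_diff.
  rewrite {2}eqs mulgA tperm2 mul1g; lia.
case/porbitP=> i ->; rewrite permX; elim: i => [|i IHi] /=; first exact: connect0.
apply: connect_trans IHi _; rewrite facepE.
set z := iter _ _ _.
by apply: (@connect_trans _ _ (keep A z)); apply: connect1; rewrite eqxx ?orbT.
Qed.

End Deletion.

(** * Euler's formula for the subgraph of used edges *)

Section UsedSubgraph.
Variables (V D : finType) (tail : D -> V) (opp rot : D -> D).
Hypothesis plane : plane_embedding tail opp rot.

Lemma pe_oppK : involutive opp. Proof. by case: plane. Qed.
Lemma pe_tail_opp d : tail (opp d) != tail d. Proof. by case: plane => _ []. Qed.
Lemma pe_rot_inj : injective rot. Proof. by case: plane => _ [_ [_ []]]. Qed.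
Lemma pe_tail_rot d : tail (rot d) = tail d.
Proof. by case: plane => _ [_ [_ [_ []]]]. Qed.
Lemma pe_fconnect d d' : tail d = tail d' -> fconnect rot d d'.
Proof. by case: plane => _ [_ [_ [_ [_ [h _]]]]]; apply: h. Qed.
Lemma pe_opp_neq d : opp d != d.
Proof. by apply: contraNneq (pe_tail_opp d) => ->. Qed.

Lemma pe_euler :
  2 * (ncyc (rotp pe_rot_inj) + ncyc (facep pe_oppK pe_rot_inj set0)) =
  #|D| + 4 * ncomp_keep opp rot set0.
Proof.
case: plane => _ [_ [_ [_ [_ [_ eul]]]]].
have keep0 d : keep opp set0 d = opp d by rewrite /keep !inE.
have -> : ncomp_keep opp rot set0 = n_comp (dart_rel opp rot) (predT : {pred D}).
  by apply/eq_n_comp/eq_connect => x y; rewrite keep0.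
rewrite -eul -!fcard_ncyc; congr (2 * (_ + _)); apply: eq_fcard => x.
  by rewrite permE.
by rewrite facepE keep0.
Qed.

(** All edges outside [U] are deleted. A vertex left without darts of [U] (its darts form part of
    [S0]) is one cycle of the rotation, one face cycle and one component; its contributions
    [2 * (1 + 1)] and [4] to Euler's inequality cancel. *)
Lemma euler_used (U : {set D}) :
  (forall d, (opp d \in U) = (d \in U)) ->
  #|U| <= 2 * (#|tail @: U| + #|porbit (facep pe_oppK pe_rot_inj (~: U)) @: U|).
Proof.
move=> cU; set A := ~: U; set rp := rotp pe_rot_inj.
set fp := facep _ _ _.
have cA d : (opp d \in A) = (d \in A) by rewrite !inE cU.
have eul := euler_delete pe_opp_neq cA pe_euler.
rewrite -/fp -/rp in eul.
pose S0 := [set x | [disjoint porbit rp x & U]].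
have rpE x : rp x = rot x by rewrite permE.
have S0rot x : (rot x \in S0) = (x \in S0).
  by rewrite !inE -rpE porbit_step.
have S0U x : x \in S0 -> x \notin U.
  by rewrite inE => /disjointFr -> //; apply: porbit_id.
have keepS0 x : x \in S0 -> keep opp A x = x.
  by move/S0U => nU; rewrite /keep inE nU.
have split (s : {perm D}) (B : {set D}) (C : {set D}) :
    (forall x, x \in B \/ exists2 y, y \in C & porbit s x = porbit s y) ->
    ncyc s <= #|porbit s @: C| + #|porbit s @: B|.
  move=> h; have [le _] := leq_card_setU (porbit s @: C) (porbit s @: B).
  apply: leq_trans le; apply: subset_leq_card.
  apply/subsetP => _ /imsetP[x _ ->]; rewrite inE.
  case: (h x) => [xB|[y yC ->]].
    by rewrite (imset_f (porbit s) xB) orbT.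
  by rewrite (imset_f (porbit s) yC).
have cV : ncyc rp <= #|tail @: U| + #|porbit rp @: S0|.
  apply: leq_trans (split rp S0 U _) _.
    move=> x; case: (boolP (x \in S0)); first by left.
    rewrite inE => /pred0Pn[y /= /andP[yx yU]]; right; exists y => //.
    by apply/eqP; rewrite eq_porbit_mem porbit_sym.
  rewrite leq_add2r; apply: leq_card_imset_factor => x y _ _ exy.
  apply/eqP; rewrite eq_porbit_mem porbit_fconnect.
  by rewrite (eq_fconnect rpE); apply: pe_fconnect.
have fpS0 x i : x \in S0 -> iter i fp x = iter i rp x /\ iter i rp x \in S0.
  move=> xS; elim: i => //= i [-> IH].
  by rewrite facepE keepS0 // rpE S0rot.
have cF : ncyc fp <= #|porbit fp @: U| + #|porbit rp @: S0|.
  have fpS0o x : x \in S0 -> porbit fp x = porbit rp x.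
    move=> xS; apply/setP => y.
    by apply/porbitP/porbitP => -[i ->]; exists i; rewrite !permX;
      case: (fpS0 x i xS).
  apply: leq_trans (split fp S0 U _) _; last first.
    by rewrite leq_add2l (eq_in_imset fpS0o).
  move=> x; have [dis|] := boolP [disjoint porbit fp x & U]; last first.
    move/pred0Pn => [y /= /andP[yx yU]]; right; exists y => //.
    by apply/eqP; rewrite eq_porbit_mem porbit_sym.
  left; rewrite inE.
  suff -> : porbit rp x = porbit fp x by [].
  have it i : iter i fp x = iter i rp x.
    elim: i => //= i IH; rewrite -IH facepE rpE /keep inE.
    rewrite (disjointFr dis) //=.
    by rewrite -permX mem_porbit.
  apply/setP => y; apply/porbitP/porbitP => -[i ->]; exists i;
    by rewrite !permX it.
have cC : #|porbit rp @: S0| <= ncomp_keep opp rot A.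
  rewrite /ncomp_keep n_comp_roots; set e := (fun _ _ => _).
  have se : connect_sym e.
    exact: connect_sym_perms (inv_inj (keepK pe_oppK A)) pe_rot_inj.
  pose f z := if z \in S0 then Some (porbit rp z) else None.
  have fe x y : e x y -> f x = f y.
    case/orP => /eqP ->; rewrite /f; last first.
      by rewrite S0rot -rpE porbit_step.
    have [xS|xS] := boolP (x \in S0); first by rewrite keepS0 // xS.
    rewrite /keep; have [_|/norP[_ nA]] := boolP (_ || _).
      by rewrite (negPf xS).
    case: ifP => // /S0U.
    by move: nA; rewrite !inE negbK => ->.
  apply: leq_trans (_ : #|root e @: S0| <= _); last first.
    apply: subset_leq_card; apply/subsetP => _ /imsetP[x _ ->].
    by rewrite inE roots_root.
  apply: leq_card_imset_factor => x y xS yS /(rootP se).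
  by move/(connect_invariant fe); rewrite /f xS yS => -[].
have cU' : #|A| + #|U| = #|D| by rewrite addnC cardsC.
by move: eul cV cF cC cU'; lia.
Qed.

End UsedSubgraph.

(** * The darts of a path *)

Section Paths.
Variables (V D : finType) (tail : D -> V) (opp rot : D -> D).
Hypothesis plane : plane_embedding tail opp rot.
Let oppK := pe_oppK plane.

Notation dhead := (dhead tail opp).
Notation pverts := (pverts tail opp).
Notation is_gpath := (is_gpath tail opp).
Notation edge_on := (edge_on opp).
Implicit Types (p : gpath V D) (d : D).

Lemma edge_on_opp d p : edge_on (opp d) p = edge_on d p.
Proof. by rewrite /Defs.edge_on oppK orbC. Qed.

(** The default value marks the ends: for a dart [d] of a path, [other p d = d] exactly when [d]
    leaves an endpoint of the path. *)
Definition other_dart p d : D :=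
  odflt d [pick d' | [&& edge_on d' p, tail d' == tail d & d' != d]].
Notation other := other_dart.

Lemma tail_other p d : tail (other p d) = tail d.
Proof. by rewrite /other; case: pickP => //= d' /and3P[_ /eqP]. Qed.

Lemma edge_on_other p d : edge_on d p -> edge_on (other p d) p.
Proof. by rewrite /other; case: pickP => //= d' /and3P[]. Qed.

Lemma walk_tail d0 v s i : walk_from tail opp v s -> i < size s ->
  tail (nth d0 s i) = nth v (v :: map dhead s) i.
Proof.
elim: s v i => // d s IHs v [|i] /= /andP[/eqP td w] //.
rewrite ltnS => lt_i; rewrite (IHs _ _ w) //.
by apply: set_nth_default; rewrite /= size_map ltnW.
Qed.

Section OnePath.
Variable p : gpath V D.
Hypothesis pP : is_gpath p.
Let vs i := nth p.1 (pverts p) i.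
Let n := size p.2.

Lemma tail_nth d0 i : i < n -> tail (nth d0 p.2 i) = vs i.
Proof. by case/andP: pP => w _; apply: walk_tail. Qed.

Lemma dhead_nth d0 i : i < n -> dhead (nth d0 p.2 i) = vs i.+1.
Proof. by move=> lt_i; rewrite /vs /= (nth_map d0). Qed.

Lemma vs_inj i j : i <= n -> j <= n -> vs i = vs j -> i = j.
Proof.
case/andP: pP => _ u le_i le_j /eqP.
rewrite nth_uniq //= ?size_map ?ltnS //.
by move/eqP.
Qed.

Lemma edge_onP d0 d : reflect (exists2 i, i < n &
    d = nth d0 p.2 i \/ d = opp (nth d0 p.2 i)) (edge_on d p).
Proof.
apply: (iffP orP) => [[]/(nthP d0)[i lt_i e]|[i lt_i [->|->]]].
- by exists i => //; left.
- by exists i => //; right; rewrite e oppK.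
- by left; apply: mem_nth.
- by right; rewrite oppK; apply: mem_nth.
Qed.

Lemma edge_on_nth d0 i : i < n -> edge_on (nth d0 p.2 i) p.
Proof. by move=> lt_i; apply/(edge_onP d0); exists i => //; left. Qed.

Lemma nth_neq_opp d0 i j : i < n -> j < n -> nth d0 p.2 i <> opp (nth d0 p.2 j).
Proof.
move=> lt_i lt_j e.
have e1 : vs i = vs j.+1 by rewrite -(tail_nth d0 lt_i) -(dhead_nth d0 lt_j) e.
have e2 : vs i.+1 = vs j
  by rewrite -(dhead_nth d0 lt_i) -(tail_nth d0 lt_j) /Defs.dhead e oppK.
have := vs_inj (ltnW lt_i) lt_j e1; have := vs_inj lt_i (ltnW lt_j) e2; lia.
Qed.

Lemma at_vertex d0 d : edge_on d p -> exists m, tail d = vs m /\ m <= n /\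
  ((m < n /\ d = nth d0 p.2 m) \/ (0 < m /\ d = opp (nth d0 p.2 m.-1))).
Proof.
case/(edge_onP d0)=> i lt_i [->|->].
  by exists i; rewrite tail_nth //; split=> //; split; [apply: ltnW | left].
by exists i.+1; rewrite -(dhead_nth d0) //; split=> //; split=> //; right.
Qed.

Lemma two_darts d d1 d2 : edge_on d p -> edge_on d1 p -> edge_on d2 p ->
  tail d1 = tail d -> tail d2 = tail d -> d1 != d -> d2 != d -> d1 = d2.
Proof.
move=> /(at_vertex d)[i [ti [le_i Hi]]] /(at_vertex d)[j [tj [le_j Hj]]].
move=> /(at_vertex d)[k [tk [le_k Hk]]].
rewrite ti tj tk => /(vs_inj le_j le_i) e /(vs_inj le_k le_i) e'; subst j k.
by case: Hi => -[_ ei]; case: Hj => -[_ ej]; case: Hk => -[_ ek];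
  rewrite ?ej ?ek -?ei ?eqxx.
Qed.

Lemma other_eq d d' : edge_on d p -> edge_on d' p -> tail d' = tail d ->
  d' != d -> other p d = d'.
Proof.
move=> dp dp' t nd; rewrite /other.
case: pickP => [d2 /and3P[d2p /eqP t2 n2]|/(_ d')] /=.
  exact: (two_darts dp d2p dp').
by rewrite dp' t eqxx nd.
Qed.

Lemma otherK d : edge_on d p -> other p (other p d) = d.
Proof.
move=> dp; have [e|ne] := eqVneq (other p d) d; first by rewrite !e.
apply: other_eq => //; first exact: edge_on_other.
  by rewrite tail_other.
by rewrite eq_sym.
Qed.

Lemma other_nth d0 i : i.+1 < n -> other p (nth d0 p.2 i.+1) = opp (nth d0 p.2 i).
Proof.
move=> lt_i; have lt_i' : i < n by apply: ltnW.
apply: other_eq; rewrite ?edge_on_opp ?edge_on_nth //.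
  by rewrite tail_nth // -(dhead_nth d0).
by apply/eqP => e; have := nth_neq_opp lt_i lt_i' (esym e).
Qed.

Lemma other_nth_opp d0 i : i.+1 < n -> other p (opp (nth d0 p.2 i)) = nth d0 p.2 i.+1.
Proof. by move=> lt_i; rewrite -other_nth // otherK // edge_on_nth. Qed.

Lemma other_first d0 : 0 < n -> other p (nth d0 p.2 0) = nth d0 p.2 0.
Proof.
move=> n0; have p0 := edge_on_nth d0 n0; have := tail_other p (nth d0 p.2 0).
case/(at_vertex d0): (edge_on_other p0) => m [-> [le_m Hm]].
rewrite tail_nth // => /(vs_inj le_m (leq0n _)) e; subst m.
by case: Hm => -[].
Qed.

Lemma other_last d0 : 0 < n ->
  other p (opp (nth d0 p.2 n.-1)) = opp (nth d0 p.2 n.-1).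
Proof.
move=> n0; have lt_n : n.-1 < n by rewrite prednK.
have p0 : edge_on (opp (nth d0 p.2 n.-1)) p by rewrite edge_on_opp edge_on_nth.
have := tail_other p (opp (nth d0 p.2 n.-1)).
case/(at_vertex d0): (edge_on_other p0) => m [-> [le_m Hm]].
rewrite -/(dhead _) dhead_nth // prednK // => /(vs_inj le_m (leqnn _)) e; subst m.
by case: Hm => -[]; rewrite ?ltnn.
Qed.

Lemma card_path_ends : #|[set d | edge_on d p && (other p d == d)]| <= 2.
Proof.
have [n0|n0] := posnP n.
  rewrite (_ : [set _ | _] = set0) ?cards0 //; apply/setP => d; rewrite !inE.
  by rewrite /Defs.edge_on (size0nil n0).
have d0 : D by move: n0; rewrite /n; case: (p.2).
apply: leq_trans (_ : #|[set nth d0 p.2 0; opp (nth d0 p.2 n.-1)]| <= 2);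
  last first.
  by rewrite cards2; case: (_ == _).
apply: subset_leq_card; apply/subsetP => d; rewrite !inE => /andP[].
case/(edge_onP d0) => i lt_i [->|->].
  case: i lt_i => [_ _|i lt_i]; first by rewrite eqxx.
  rewrite other_nth // => /eqP e.
  by have := nth_neq_opp lt_i (ltnW lt_i) (esym e).
have [lt_i1|ge_i1] := ltnP i.+1 n.
  rewrite other_nth_opp // => /eqP e.
  by have := nth_neq_opp lt_i1 (ltnW lt_i1) e.
by move=> _; rewrite (_ : i = n.-1) ?eqxx ?orbT //; lia.
Qed.

(** The walk [th] runs forward along the path, turns at its last vertex because [other] fixes the
    end dart, runs back along the reversed darts and turns again. Thus a path is a single cycle. *)
Lemma around_path d d' : edge_on d p -> edge_on d' p ->
  exists k, iter k (fun x => other p (opp x)) d = d'.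
Proof.
move=> dp d'p; pose th x := other p (opp x); change (exists k, iter k th d = d').
have n0 : 0 < n by case/(edge_onP d): dp => i; lia.
pose s := nth d p.2.
have fwd i : i.+1 < n -> th (s i) = s i.+1 by apply: other_nth_opp.
have bwd i : i.+1 < n -> th (opp (s i.+1)) = opp (s i).
  by move=> lt_i; rewrite /th oppK; apply: other_nth.
have turn : th (s n.-1) = opp (s n.-1) by apply: other_last.
have turn0 : th (opp (s 0)) = s 0 by rewrite /th oppK; apply: other_first.
have itf i k : i + k < n -> iter k th (s i) = s (i + k).
  elim: k => [|k IHk] lt_k /=; first by rewrite addn0.
  rewrite IHk; last by lia.
  by rewrite addnS fwd // -addnS.
have itb i k : i + k < n -> iter k th (opp (s (i + k))) = opp (s i).
  elim: k => [|k IHk] lt_k; first by rewrite addn0.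
  by rewrite iterSr addnS bwd ?IHk //; lia.
have from0 u : edge_on u p -> exists k, iter k th (s 0) = u.
  case/(edge_onP d) => i lt_i [->|->]; first by exists i; rewrite itf.
  exists ((n.-1 - i) + (1 + n.-1)); rewrite !iterD itf ?add0n /= ?turn; last by lia.
  have {2}-> : n.-1 = i + (n.-1 - i) by lia.
  by rewrite itb //; lia.
have to0 u : edge_on u p -> exists k, iter k th u = s 0.
  have toL i : i < n -> exists k, iter k th (opp (s i)) = s 0.
    by move=> lt_i; exists i.+1; rewrite iterS -{2}[i]add0n itb ?turn0.
  case/(edge_onP d) => i lt_i [->|->]; last exact: toL.
  have lt_n : n.-1 < n by lia.
  have [k <-] := toL _ lt_n; exists (k + (1 + (n.-1 - i))).
  rewrite !iterD itf /=; last by lia.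
  have -> : i + (n.-1 - i) = n.-1 by lia.
  by rewrite turn.
have [k1 e1] := to0 d dp; have [k2 e2] := from0 d' d'p.
by exists (k2 + k1); rewrite iterD e1.
Qed.

End OnePath.
End Paths.

(** * Cyclic positions and path reversal *)

Section Rotation.
Variables (V D : finType) (tail : D -> V) (opp rot : D -> D).
Hypothesis plane : plane_embedding tail opp rot.
Let rot_inj := pe_rot_inj plane.

(** The cyclic order at a vertex is cut open at [froot], which all its darts share, so positions can
    be compared linearly. *)
Definition rotpos (d : D) : nat := findex rot (froot rot d) d.
Notation rpos := rotpos.

Lemma order_tail d a : tail d = tail a -> fingraph.order rot d = fingraph.order rot a.
Proof.
move=> /(pe_fconnect plane) c; apply: eq_card => x.
exact: (same_connect (fconnect_sym rot_inj) c).
Qed.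

Lemma froot_tail d a : tail d = tail a -> froot rot d = froot rot a.
Proof. by move=> /(pe_fconnect plane) /(rootP (fconnect_sym rot_inj)). Qed.

Lemma fconnect_root d : fconnect rot (froot rot d) d.
Proof. by rewrite (fconnect_sym rot_inj) connect_root. Qed.

Lemma order_root d : fingraph.order rot (froot rot d) = fingraph.order rot d.
Proof.
apply: eq_card => x; apply: (same_connect (fconnect_sym rot_inj)).
exact: fconnect_root.
Qed.

Lemma rpos_lt d : rpos d < fingraph.order rot d.
Proof. by rewrite -order_root findex_max // fconnect_root. Qed.

Lemma iter_rpos d : iter (rpos d) rot (froot rot d) = d.
Proof. by rewrite iter_findex // fconnect_root. Qed.

Lemma rpos_inj d a : tail d = tail a -> rpos d = rpos a -> d = a.
Proof.
by move=> /froot_tail e1 e2; rewrite -(iter_rpos d) -(iter_rpos a) e1 e2.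
Qed.

Lemma findex_rpos d a : tail d = tail a ->
  findex rot d a = if rpos d <= rpos a then rpos a - rpos d
                   else rpos a + fingraph.order rot d - rpos d.
Proof.
move=> t; have e := froot_tail t; have o := order_tail t.
have ltd := rpos_lt d; have lta := rpos_lt a.
have it m : iter m rot d = iter (m + rpos d) rot (froot rot d).
  by rewrite iterD iter_rpos.
have [le|gt] := leqP (rpos d) (rpos a).
  have {1}-> : a = iter (rpos a - rpos d) rot d.
    by rewrite it subnK // e iter_rpos.
  by rewrite findex_iter //; lia.
have {1}-> : a = iter (rpos a + fingraph.order rot d - rpos d) rot d.
  rewrite it subnK; last by lia.
  by rewrite iterD -{1}order_root iter_order // e iter_rpos.
by rewrite findex_iter //; lia.
Qed.

Lemma findex_rot d a : tail d = tail a -> a != d ->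
  (findex rot (rot d) a).+1 = findex rot d a.
Proof.
move=> t na; have c := pe_fconnect plane t.
have f0 : 0 < findex rot d a by rewrite lt0n findex_eq0 eq_sym.
have lt := findex_max c.
have -> : findex rot (rot d) a = (findex rot d a).-1; last by rewrite prednK.
have {1}-> : a = iter (findex rot d a).-1 rot (rot d).
  by rewrite -iterSr prednK // iter_findex.
rewrite findex_iter // (@order_tail _ d) ?(pe_tail_rot plane) //; lia.
Qed.

Lemma findex_neq d a b : tail d = tail a -> tail d = tail b -> a != b ->
  findex rot d a != findex rot d b.
Proof.
move=> ta tb; apply: contraNneq => e.
rewrite -(iter_findex (pe_fconnect plane ta)) e.
by rewrite (iter_findex (pe_fconnect plane tb)).
Qed.

End Rotation.

Section Reversal.
Variables (V D : finType) (tail : D -> V) (opp rot : D -> D).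
Hypothesis plane : plane_embedding tail opp rot.
Let oppK := pe_oppK plane.
Let opp_inj := inv_inj oppK.
Notation dhead := (dhead tail opp).
Notation pverts := (pverts tail opp).
Notation is_gpath := (is_gpath tail opp).
Notation plast := (plast tail opp).
Notation prev := (Defs.prev tail opp).
Notation edge_on := (edge_on opp).
Notation other := (other_dart tail opp).
Implicit Types (p q : gpath V D) (d : D).

Lemma walk_rcons v s x :
  walk_from tail opp v (rcons s x) =
  walk_from tail opp v s && (tail x == last v (map dhead s)).
Proof.
by elim: s v => [|d s IHs] v /=; rewrite ?andbT // IHs andbA.
Qed.

Lemma walk_verts v s : walk_from tail opp v s ->
  v :: map dhead s = rcons (map tail s) (last v (map dhead s)).
Proof. by elim: s v => //= d s IHs v /andP[/eqP -> /IHs ->]. Qed.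

Lemma walk_rev v s : walk_from tail opp v s ->
  walk_from tail opp (last v (map dhead s)) (rev (map opp s)).
Proof.
elim: s v => //= d s IHs v /andP[/eqP td w].
rewrite rev_cons walk_rcons IHs //= -map_rev -map_comp.
rewrite [X in last _ X](eq_map (g := tail)); last by move=> x /=;
  rewrite /Defs.dhead oppK.
case: s w {IHs} => //= x s /andP[/eqP tx _].
by rewrite rev_cons map_rcons last_rcons tx.
Qed.

Lemma map_dhead_opp s : map dhead (map opp s) = map tail s.
Proof. by rewrite -map_comp; apply: eq_map => x /=; rewrite /Defs.dhead oppK. Qed.

Lemma pverts_prev p : is_gpath p -> pverts (prev p) = rev (pverts p).
Proof.
case/andP=> w _; rewrite /Defs.pverts /= (walk_verts w) rev_rcons.
by rewrite map_rev map_dhead_opp.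
Qed.

Lemma is_gpath_prev p : is_gpath p -> is_gpath (prev p).
Proof.
move=> pP; apply/andP; split; last by rewrite pverts_prev // rev_uniq;
  case/andP: pP.
by case/andP: pP => w _; apply: walk_rev.
Qed.

Lemma plast_prev p : is_gpath p -> plast (prev p) = p.1.
Proof.
move=> pP; rewrite /Defs.plast -[last _ _]/(last (plast p) (pverts (prev p))).
by rewrite pverts_prev //= rev_cons last_rcons.
Qed.

Lemma edge_on_prev d p : edge_on d (prev p) = edge_on d p.
Proof.
rewrite /Defs.edge_on /= !mem_rev (mem_map opp_inj) orbC; congr (_ || _).
by rewrite -{1}(oppK d) (mem_map opp_inj).
Qed.

Lemma other_prev p d : other (prev p) d = other p d.
Proof. by rewrite /other_dart; congr odflt; apply: eq_pick => x;
  rewrite edge_on_prev. Qed.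

Lemma other_cat p a e d r : is_gpath p -> p.2 = a ++ e :: d :: r ->
  other p d = opp e.
Proof.
move=> pP ep.
have := other_nth plane pP d (i := size a).
rewrite ep size_cat !nth_cat /= !addnS ltnn subnn.
have -> : (size a).+1 < size a = false by lia.
have -> : (size a).+1 - size a = 1 by lia.
by move/(_ _)->; rewrite //; lia.
Qed.

End Reversal.

(** * Comparing paths through a common dart *)

Section Weights.
Variables (V D : finType) (tail : D -> V) (opp rot : D -> D).
Hypothesis plane : plane_embedding tail opp rot.
Let oppK := pe_oppK plane.
Let opp_inj := inv_inj oppK.
Notation is_gpath := (is_gpath tail opp).
Notation prev := (Defs.prev tail opp).
Notation other := (other_dart tail opp).
Implicit Types (p q : gpath V D) (d : D).

(* A base [#|D|+1] number whose digits record the turns of [p] along the walk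
   that leaves [d] backwards through [tail d]: comparing weights compares two
   paths through [d] at the first vertex behind [d] where they part.  The
   digits are complemented so that smaller weights are the copies of [d] that
   come first clockwise around [tail d]. *)
Fixpoint weight p k d : nat :=
  if k is k'.+1 then
    (#|D| - findex rot d (other p d)) * #|D|.+1 ^ k' + weight p k' (opp (other p d))
  else 0.

Fixpoint diverge p q k d : bool :=
  if k is k'.+1 then
    (other p d != other q d) || diverge p q k' (opp (other p d))
  else false.

Lemma weight_lt p k d : weight p k d < #|D|.+1 ^ k.
Proof.
elim: k d => // k IHk d /=; rewrite expnS.
have := IHk (opp (other p d)); set x := weight _ _ _; set y := _ ^ _ => lt_xy.
have le : (#|D| - findex rot d (other p d)) * y <= #|D| * y.
  by apply: leq_mul => //; apply: leq_subr.
by rewrite mulSn; lia.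
Qed.

Lemma findex_other_lt p d : findex rot d (other p d) < #|D|.
Proof.
apply: leq_trans (findex_max _) _; last exact: max_card.
by apply: (pe_fconnect plane); rewrite tail_other.
Qed.

(** By [weight_lt] the lower digits amount to less than one unit of the leading digit, so the
    leading digits decide; complementing them reverses the comparison. *)
Lemma weight_parted p q k d : other p d != other q d ->
  (weight p k.+1 d < weight q k.+1 d) =
  (findex rot d (other q d) < findex rot d (other p d)).
Proof.
move=> ne /=.
have := weight_lt p k (opp (other p d)); have := weight_lt q k (opp (other q d)).
set x := weight _ _ _; set x' := weight _ _ _; set y := _ ^ _ => lt1 lt2.
have lp := findex_other_lt p d; have lq := findex_other_lt q d.
have := findex_neq plane (esym (tail_other tail opp p d))
  (esym (tail_other tail opp q d)) ne.
set fp := findex _ _ _ in lp *; set fq := findex _ _ _ in lq * => nf.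
have [lt|gt|/eqP] := ltngtP fq fp; last by rewrite eq_sym (negPf nf).
  have : (#|D| - fp).+1 * y <= (#|D| - fq) * y by apply: leq_mul => //; lia.
  by rewrite mulSn; set u := _ * _; set v := _ * _ => ?; apply/idP; lia.
have : (#|D| - fq).+1 * y <= (#|D| - fp) * y by apply: leq_mul => //; lia.
rewrite mulSn; set u := _ * _; set v := _ * _ => ?.
by apply/negbTE; rewrite -leqNgt; lia.
Qed.

Lemma weight_together p q k d : other p d = other q d ->
  (weight p k.+1 d < weight q k.+1 d) =
  (weight p k (opp (other p d)) < weight q k (opp (other p d))).
Proof. by move=> /= <-; rewrite ltn_add2l. Qed.

(** Digits after the parting cannot change the comparison. This absorbs the digit that is lost when
    moving on by one edge. *)
Lemma weight_fuel p q k m d : diverge p q k d -> k <= m ->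
  (weight p m d < weight q m d) = (weight p k d < weight q k d).
Proof.
elim: k m d => // k IHk [//|m] d dv le_km.
have [e|ne] := eqVneq (other p d) (other q d); last by rewrite !weight_parted.
by rewrite !weight_together // IHk //; move: dv; rewrite /= e eqxx.
Qed.

Lemma diverge_leq p q k m d : k <= m -> diverge p q k d -> diverge p q m d.
Proof.
elim: k m d => // k IHk [//|m] d le_km /= /orP[->//|dv].
by rewrite (IHk m) ?orbT.
Qed.

Lemma diverge_sym p q k d : diverge p q k d = diverge q p k d.
Proof.
elim: k d => //= k IHk d; rewrite eq_sym.
by have [->|] := eqVneq (other q d) (other p d); rewrite ?IHk.
Qed.

Lemma weight_neq p q k d : diverge p q k d -> weight p k d != weight q k d.
Proof.
elim: k d => // k IHk d.
have [e|ne] := eqVneq (other p d) (other q d); last first.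
  move=> _; have := weight_parted k ne; have := weight_parted k.
  move/(_ q p d); rewrite eq_sym => /(_ ne).
  have := findex_neq plane (esym (tail_other tail opp p d))
    (esym (tail_other tail opp q d)) ne.
  by rewrite !neq_ltn => nf -> ->; rewrite orbC.
by rewrite /= e eqxx eqn_add2l /= => /IHk.
Qed.

Lemma weight_prev p k d : weight (prev p) k d = weight p k d.
Proof. by elim: k d => //= k IHk d; rewrite (other_prev plane) IHk. Qed.

Lemma diverge_prev p q k d :
  (diverge (prev p) q k d = diverge p q k d) *
  (diverge p (prev q) k d = diverge p q k d).
Proof.
by elim: k d => //= k IHk d; rewrite !(other_prev plane) !IHk.
Qed.

(** Backwards from [d] the digits agree along [c], up to the first common dart [head d c], which is
    preceded by [e] on one path and by [g] on the other. *)
Lemma weight_back p q a e c d r a' g r' k :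
  is_gpath p -> is_gpath q ->
  p.2 = (a ++ e :: c) ++ d :: r -> q.2 = (a' ++ g :: c) ++ d :: r' ->
  e != g -> size c < k ->
  diverge p q (size c).+1 d /\
  (weight p k d < weight q k d) =
    (findex rot (head d c) (opp g) < findex rot (head d c) (opp e)).
Proof.
move=> pP qP; elim/last_ind: c d r r' k => [|c x IHc] d r r' [//|k] ep eq neg lt_k.
  rewrite -catA /= in ep; rewrite -catA /= in eq.
  have op := other_cat plane pP ep; have oq := other_cat plane qP eq.
  have ne : other p d != other q d by rewrite op oq (inj_eq opp_inj).
  by rewrite weight_parted //= op oq -{1}op -{1}oq ne.
have ep' : p.2 = (a ++ e :: c) ++ x :: d :: r by rewrite ep -cats1 -!catA /= -catA.
have eq' : q.2 = (a' ++ g :: c) ++ x :: d :: r'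
  by rewrite eq -cats1 -!catA /= -catA.
have op := other_cat plane pP ep'; have oq := other_cat plane qP eq'.
rewrite size_rcons in lt_k *.
have [dv lt] := IHc _ _ _ k ep' eq' neg lt_k.
rewrite weight_together ?op ?oq // oppK lt; split; last by rewrite headI.
by rewrite [X in is_true X]/= op oq eqxx oppK /=.
Qed.

End Weights.

(** * Uncrossed paths along a common subpath *)

Lemma uniq_split (T : eqType) (f : T) x1 y1 x2 y2 :
  uniq (x1 ++ f :: y1) -> x1 ++ f :: y1 = x2 ++ f :: y2 -> x1 = x2 /\ y1 = y2.
Proof.
elim: x1 x2 => [|a x1 IHx] [|b x2] /=.
- by move=> _ [].
- move=> /andP[nf _] [e1 e2]; case/negP: nf.
  by rewrite e2 mem_cat inE eqxx orbT.
- move=> /andP[nf _] [e1 e2]; case/negP: nf.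
  by rewrite e1 mem_cat inE eqxx orbT.
by move=> /andP[_ u] [-> /(IHx _ u)[-> ->]].
Qed.

Section Crossing.
Variables (V D : finType) (tail : D -> V) (opp rot : D -> D).
Hypothesis plane : plane_embedding tail opp rot.
Let oppK := pe_oppK plane.
Let opp_inj := inv_inj oppK.
Notation dhead := (dhead tail opp).
Notation pverts := (pverts tail opp).
Notation is_gpath := (is_gpath tail opp).
Notation plast := (plast tail opp).
Notation prev := (Defs.prev tail opp).
Notation subpath := (subpath tail opp).
Notation max_common := (max_common tail opp).
Notation no_endpoint := (no_endpoint tail opp).
Implicit Types (p q Z : gpath V D) (d : D).

Definition rev_opp (s : seq D) := rev (map opp s).
Notation ropp := rev_opp.

Lemma roppK : involutive ropp.
Proof.
by move=> s; rewrite /ropp map_rev revK -map_comp -{2}[s]map_id; apply: eq_map.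
Qed.

Lemma ropp_cat s t : ropp (s ++ t) = ropp t ++ ropp s.
Proof. by rewrite /ropp map_cat rev_cat. Qed.

Lemma infix_ropp s t : infix (ropp s) (ropp t) = infix s t.
Proof.
suff h x y : infix x y -> infix (ropp x) (ropp y).
  by apply/idP/idP => [/h|/h//]; rewrite !roppK.
by case/infixP => u [w ->]; apply/infixP; exists (ropp w), (ropp u);
  rewrite !ropp_cat catA.
Qed.

Lemma infix_roppl s t : infix (ropp s) t = infix s (ropp t).
Proof. by rewrite -infix_ropp roppK. Qed.

Lemma subpath_prev Z q : is_gpath q -> subpath Z (prev q) = subpath Z q.
Proof.
move=> qP; rewrite /Defs.subpath (pverts_prev plane) // mem_rev;
  congr [&& _, _ & _].
by rewrite -[(prev q).2]/(ropp q.2) -[(prev Z).2]/(ropp Z.2) infix_ropp -infix_roppl orbC.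
Qed.

Lemma no_endpoint_prev Z q : is_gpath q -> no_endpoint Z (prev q) = no_endpoint Z q.
Proof. by move=> qP; rewrite /Defs.no_endpoint (plast_prev plane) // andbC. Qed.

Lemma max_common_prev Z p q : is_gpath q -> max_common Z p (prev q) -> max_common Z p q.
Proof.
move=> qP []; rewrite subpath_prev // => h1 h2; split=> // Z' z1 z2.
by apply: h2; rewrite ?subpath_prev.
Qed.

Lemma uniq_darts p : is_gpath p -> uniq p.2.
Proof. by case/andP=> _ /= /andP[_ /map_uniq]. Qed.

Lemma dart_not_opp p d : is_gpath p -> d \in p.2 -> opp d \notin p.2.
Proof.
move=> pP /(nthP d)[i lt_i ei]; apply/negP => /(nthP d)[j lt_j ej].
by apply: (nth_neq_opp plane pP (d0 := d) lt_j lt_i); rewrite ej ei.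
Qed.

Lemma walk_cat v s t : walk_from tail opp v (s ++ t) =
  walk_from tail opp v s && walk_from tail opp (last v (map dhead s)) t.
Proof. by elim: s v => //= d s IHs v; rewrite IHs andbA. Qed.

Section Middle.
Variables (p : gpath V D) (a : seq D) (e : D) (z : seq D) (e' : D) (b : seq D).
Hypothesis pP : is_gpath p.
Hypothesis ep : p.2 = a ++ e :: z ++ e' :: b.
Let Z : gpath V D := (dhead e, z).

Lemma pverts_middle : pverts p =
  (p.1 :: map dhead a) ++ pverts Z ++ map dhead (e' :: b).
Proof. by rewrite /Defs.pverts ep !map_cat /= map_cat. Qed.

Lemma gpath_middle : is_gpath Z.
Proof.
case/andP: (pP) => w u; apply/andP; split.
  by move: w; rewrite ep walk_cat /= walk_cat => /and3P[_ _ /andP[]].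
by move: u; rewrite pverts_middle catA !cat_uniq => /andP[/and3P[]].
Qed.

Lemma no_endpoint_middle : no_endpoint Z p.
Proof.
case/andP: (pP) => _ u; have lst : plast p \in map dhead (e' :: b).
  by rewrite /Defs.plast ep map_cat last_cat /= map_cat last_cat /= mem_last.
move: u; rewrite pverts_middle => u; apply/andP; split.
  move: u; rewrite cat_uniq => /and3P[_ /hasPn h _]; apply/negP => h1.
  by have := h p.1; rewrite mem_cat h1 => /(_ isT); rewrite /= inE eqxx.
move: u; rewrite catA cat_uniq => /and3P[_ /hasPn /(_ _ lst)].
by rewrite mem_cat negb_or => /andP[].
Qed.

Lemma subpath_middle : subpath Z p.
Proof.
rewrite /Defs.subpath gpath_middle pverts_middle !mem_cat !inE eqxx !orbT /=.
apply/orP; left; apply/infixP; exists (rcons a e), (e' :: b).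
by rewrite ep cat_rcons.
Qed.

Lemma tail_middle_end : tail e' = last (dhead e) (map dhead z).
Proof.
by case/andP: pP => w _; move: w;
  rewrite ep walk_cat /= walk_cat /= => /and4P[_ _ _ /andP[/eqP]].
Qed.

End Middle.

(** A common subpath extending [f0 :: z] would have to continue by [e] and [g] at the front, or by
    [e'] and [g'] at the back, and these differ. *)
Lemma max_common_middle p q a e z e' b a' g g' b' f0 :
  is_gpath p -> is_gpath q ->
  p.2 = a ++ e :: (f0 :: z) ++ e' :: b -> q.2 = a' ++ g :: (f0 :: z) ++ g' :: b' ->
  e != g -> e' != g' -> dhead e = dhead g -> max_common (dhead e, f0 :: z) p q.
Proof.
move=> pP qP ep eq ne ne' hd; split.
  by rewrite (subpath_middle pP ep) hd (subpath_middle qP eq).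
move=> Z' zp zq zz.
(* Orient [Z'] so that it contains [f0 :: z] forwards. Since a path never contains a dart together
   with its reverse, [y] then lies forwards on both paths. *)
pose y := if infix (f0 :: z) Z'.2 then Z'.2 else ropp Z'.2.
have iy : infix (f0 :: z) y.
  case/and3P: zz => _ _ /orP[]; rewrite /y /=; first by move=> i; rewrite i.
  by rewrite -[rev _]/(ropp (f0 :: z)) infix_roppl; case: ifP.
have key s : is_gpath s -> f0 \in s.2 -> subpath Z' s -> infix y s.2.
  move=> sP fs /and3P[_ _ h].
  have {h} h : infix y s.2 || infix (ropp y) s.2.
    by move: h; rewrite -[(prev Z').2]/(ropp Z'.2) /y; case: ifP;
      rewrite ?roppK // orbC.
  case/orP: h => // /mem_infix sub; have /negP[] := dart_not_opp sP fs.
  apply: sub; rewrite mem_rev map_f //.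
  by apply: (mem_infix iy); rewrite inE eqxx.
have fp : f0 \in p.2 by rewrite ep mem_cat !inE eqxx !orbT.
have fq : f0 \in q.2 by rewrite eq mem_cat !inE eqxx !orbT.
have sz : size Z'.2 = size y by rewrite /y; case: ifP => //;
  rewrite size_rev size_map.
rewrite sz /=; case/infixP: iy => u [w ey].
(* The dart [f0] occurs only once on a path, which fixes the place of [y]: its surplus [u] ends
   where [f0] begins, and [w] starts right after [z]. *)
have cut s t x x' t' : is_gpath s -> s.2 = t ++ x :: (f0 :: z) ++ x' :: t' ->
    infix y s.2 -> exists c c', c ++ u = rcons t x /\ w ++ c' = x' :: t'.
  move=> sP es /infixP[c [c' es']]; exists c, c'.
  have us := uniq_darts sP.
  have e1 : (c ++ u) ++ f0 :: z ++ w ++ c' = rcons t x ++ f0 :: z ++ x' :: t'.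
    by move: es'; rewrite es ey cat_rcons -!catA /= => ->; rewrite -?catA.
  have [|->] := uniq_split _ e1.
    by rewrite e1 cat_rcons -es.
  by move/eqP; rewrite eqseq_cat // eqxx => /eqP.
have [c [c' [e1 e2]]] := cut _ _ _ _ _ pP ep (key _ pP fp zp).
have [k [k' [e3 e4]]] := cut _ _ _ _ _ qP eq (key _ qP fq zq).
have -> : y = f0 :: z; last by [].
rewrite ey; move: e1 e2 e3 e4; clear cut ey => e1 e2 e3 e4;
  case: w e2 e4 => [|w0 w]; last first.
  by move=> [e2 _] [e4 _]; rewrite -e2 -e4 eqxx in ne'.
move=> _ _; rewrite cats0; case/lastP: u e1 e3 => [//|u u0].
rewrite -!rcons_cat => /rcons_inj[_ e1] /rcons_inj[_ e3].
by rewrite -e1 -e3 eqxx in ne.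
Qed.

Lemma tail_arc x y d : d \in arc rot x y -> tail d = tail x.
Proof.
move/mem_take; rewrite -fconnect_orbit => c.
rewrite -(pe_tail_rot plane x); symmetry.
by apply: (connect_invariant _ c) => u v /eqP <-; rewrite (pe_tail_rot plane).
Qed.

(** The arc starts at [rot x], whence the shift by one between the index and the clockwise distance
    from [x]. *)
Lemma mem_arc_full x d : tail d = tail x -> d != x ->
  (d \in arc rot x x) /\ (index d (arc rot x x)).+1 = findex rot x d.
Proof.
move=> t nd; have c : fconnect rot (rot x) d.
  by apply: (pe_fconnect plane); rewrite (pe_tail_rot plane).
have cx : fconnect rot (rot x) x.
  by apply: (pe_fconnect plane); rewrite (pe_tail_rot plane).
have o : fingraph.order rot (rot x) = fingraph.order rot x.
  by apply: (order_tail plane); rewrite (pe_tail_rot plane).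
have fx : findex rot (rot x) x = (fingraph.order rot x).-1.
  have {2}-> : x = iter (fingraph.order rot x).-1 rot (rot x).
    by rewrite -iterSr orderSpred iter_order //; apply: (pe_rot_inj plane).
  by rewrite findex_iter // o -{2}[fingraph.order _ _]orderSpred.
have fd := findex_rot plane (esym t) nd.
have lt : findex rot (rot x) d < findex rot (rot x) x.
  have := findex_max (pe_fconnect plane (esym t)); rewrite -fd fx.
  by have := orderSpred rot x; lia.
have dt : d \in arc rot x x.
  by rewrite /arc in_take // -fconnect_orbit.
split=> //; rewrite -fd /findex.
rewrite -[X in _ = (index d X).+1](cat_take_drop (findex rot (rot x) x)).
by rewrite index_cat dt.
Qed.

Lemma mem_flatten_arc (prs : seq (D * D)) d (f : D * D -> seq D) :
  d \in flatten [seq f pr | pr <- prs] -> exists2 pr, pr \in prs & d \in f pr.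
Proof. by case/flatten_mapP => pr; exists pr. Qed.

(** In the ring around the common stretch, the darts [A] at its first vertex come before the darts
    [C] at its last one. So [opp e], [e'] fail to separate [opp g], [g'] exactly when the clockwise
    orders of the two paths at the two ends are opposite. *)
Lemma uncrossed_middle p q q' a e z e' b a' g g' b' f0 :
  is_gpath p -> is_gpath q -> q' = q \/ q' = prev q ->
  p.2 = a ++ e :: (f0 :: z) ++ e' :: b -> q'.2 = a' ++ g :: (f0 :: z) ++ g' :: b' ->
  e != g -> e' != g' -> uncrossed tail opp rot p q ->
  (findex rot f0 (opp g) < findex rot f0 (opp e)) =
  (findex rot (opp (last f0 z)) e' < findex rot (opp (last f0 z)) g').
Proof.
move=> pP qP qq' ep eq ne ne' unc.
have q'P : is_gpath q' by case: qq' => ->//; apply: (is_gpath_prev plane).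
have te : dhead e = tail f0.
  by case/andP: pP => w _; move: w; rewrite ep walk_cat /= => /and4P[_ _ /eqP ->].
have tg : dhead g = tail f0.
  by case/andP: q'P => w _; move: w; rewrite eq walk_cat /= => /and4P[_ _ /eqP ->].
have hd : dhead e = dhead g by rewrite te tg.
set fl := last f0 z.
have te' : tail e' = dhead fl by rewrite (tail_middle_end pP ep) /= last_map.
have tg' : tail g' = dhead fl by rewrite (tail_middle_end q'P eq) /= last_map.
have [//|ne_lt] := eqVneq (findex rot f0 (opp g) < findex rot f0 (opp e))
  (findex rot (opp fl) e' < findex rot (opp fl) g').
case: unc.
exists (dhead e, f0 :: z); split.
- have mc := max_common_middle pP q'P ep eq ne ne' hd.
  by case: qq' mc => -> // /(max_common_prev qP).
- exact: no_endpoint_middle ep.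
- have := no_endpoint_middle q'P eq; rewrite -hd.
  by case: qq' => -> //; rewrite no_endpoint_prev.
exists a, e, e', b, a', g, g', b'; split=> //; first by case: qq' => <-;
  [left|right].
have zP := gpath_middle pP ep; have zu : uniq (pverts (dhead e, f0 :: z))
  by case/andP: zP.
(* Since [index] finds first occurrences, no dart at the last vertex may occur already in [A] or
   [B]; this holds because the vertices of a path are distinct. *)
have ndup : forall i, i \in belast f0 z -> dhead i != dhead fl.
  move=> i ib; apply/eqP => ei; move: zu; rewrite /= => /and3P[_ n1 n2].
  have : uniq (map dhead (f0 :: z)) by rewrite /= n1.
  by rewrite lastI map_rcons rcons_uniq -/fl -ei map_f.
have nte' : dhead fl != tail f0.
  apply: contraTneq zu => h; rewrite /= te -h.
  by rewrite -[_ :: _]/(map dhead (f0 :: z)) map_f // mem_last.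
set A := arc rot f0 f0; pose prs := zip (f0 :: z) z.
pose B := flatten [seq arc rot (opp pr.1) pr.2 | pr <- prs].
pose C := arc rot (opp fl) (opp fl).
pose E := flatten (rev [seq arc rot pr.2 (opp pr.1) | pr <- prs]).
have rE : ring opp rot (f0 :: z) e' = A ++ (B ++ (C ++ E)) by [].
have [oeA oeI] : (opp e \in A) /\ (index (opp e) A).+1 = findex rot f0 (opp e).
  apply: mem_arc_full => //; apply/eqP => h.
  have /negP[] := dart_not_opp pP (d :=
    e) ltac:(by rewrite ep mem_cat inE eqxx orbT).
  by rewrite h ep mem_cat !inE eqxx !orbT.
have [ogA ogI] : (opp g \in A) /\ (index (opp g) A).+1 = findex rot f0 (opp g).
  apply: mem_arc_full => //; apply/eqP => h.
  have /negP[] := dart_not_opp q'P (d :=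
    g) ltac:(by rewrite eq mem_cat inE eqxx orbT).
  by rewrite h eq mem_cat !inE eqxx !orbT.
have flz : fl \in f0 :: z by apply: mem_last.
have [eC eI] : (e' \in C) /\ (index e' C).+1 = findex rot (opp fl) e'.
  apply: mem_arc_full => //; apply/eqP => h.
  have /negP[] := dart_not_opp pP (d :=
    fl) ltac:(by rewrite ep mem_cat inE mem_cat flz !orbT).
  by rewrite -h ep !(mem_cat, inE) eqxx !orbT.
have [gC gI] : (g' \in C) /\ (index g' C).+1 = findex rot (opp fl) g'.
  apply: mem_arc_full => //; apply/eqP => h.
  have /negP[] := dart_not_opp q'P (d :=
    fl) ltac:(by rewrite eq mem_cat inE mem_cat flz !orbT).
  by rewrite -h eq !(mem_cat, inE) eqxx !orbT.
have notA x : tail x = dhead fl -> x \notin A.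
  by move=> tx; apply/negP => /tail_arc; rewrite tx; apply/eqP.
have notB x : tail x = dhead fl -> x \notin B.
  move=> tx; apply/negP => /mem_flatten_arc[pr ppr /tail_arc]; rewrite tx.
  move=> h; have : pr.1 \in belast f0 z.
    move: ppr; rewrite /prs; elim: (z) (f0) => [|x1 z1 IHz] x0 //=.
    by rewrite inE => /orP[/eqP ->|/IHz]; rewrite inE ?eqxx // => ->; rewrite orbT.
  by move/ndup; rewrite h eqxx.
have iC x : x \in C -> tail x = dhead fl ->
    index x (A ++ (B ++ (C ++ E))) = size A + size B + index x C.
  move=> xC tx; rewrite index_cat (negPf (notA _ tx)) index_cat (negPf (notB _ tx)).
  by rewrite index_cat xC addnA.
have iA x : x \in A -> index x (A ++ (B ++ (C ++ E))) = index x A.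
  by move=> xA; rewrite index_cat xA.
rewrite /alternate rE !mem_cat oeA ogA eC gC !orbT /=.
rewrite (iA _ oeA) (iA _ ogA) (iC _ eC te') (iC _ gC tg').
have ltA x : x \in A -> index x A < size A by rewrite index_mem.
have := ltA _ oeA; have := ltA _ ogA.
move: ne_lt; rewrite -oeI -ogI -eI -gI !ltnS => ne_lt l1 l2.
have ni : index e' C != index g' C.
  apply: contraNneq ne' => h.
  by rewrite -(nth_index e' eC) h nth_index.
have ni2 : index (opp e) A != index (opp g) A.
  apply: contraNneq ne => h; apply/eqP/opp_inj.
  by rewrite -(nth_index e oeA) h nth_index.
apply/eqP => h; case/negP: ne_lt; apply/eqP; move: h.
set i1 := index (opp e) A in l1 l2 ni2 *; set i2 := index (opp g) A in l1 l2 ni2 *.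
set j1 := index e' C in ni *; set j2 := index g' C in ni *.
move: l1 l2 ni ni2; clear; lia.
Qed.

End Crossing.

(** * Uncrossed paths at a common vertex *)

Section VertexCrossing.
Variables (V D : finType) (tail : D -> V) (opp rot : D -> D).
Hypothesis plane : plane_embedding tail opp rot.
Let oppK := pe_oppK plane.
Let opp_inj := inv_inj oppK.
Notation dhead := (dhead tail opp).
Notation pverts := (pverts tail opp).
Notation is_gpath := (is_gpath tail opp).
Notation edge_on := (edge_on opp).
Notation other := (other_dart tail opp).
Notation subpath := (subpath tail opp).
Implicit Types (p q Z : gpath V D) (d : D).

Lemma chord_split p d : is_gpath p -> edge_on d p -> other p d != d ->
  exists a e e' b, p.2 = a ++ e :: e' :: b /\
    ((d = e' /\ other p d = opp e) \/ (d = opp e /\ other p d = e')).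
Proof.
move=> pP dp.
have cut m : m.+1 < size p.2 ->
    p.2 = take m p.2 ++ nth d p.2 m :: nth d p.2 m.+1 :: drop m.+2 p.2.
  by move=> lt_m; rewrite -drop_nth // -drop_nth ?cat_take_drop // ltnW.
have [m [_ [le_m [[lt_m dm]|[m0 dm]]]]] := at_vertex plane pP d dp.
  case: m lt_m dm {le_m} => [|m] lt_m dm.
    by have := other_first plane pP d lt_m; rewrite -dm => ->; rewrite eqxx.
  move=> _; exists (take m p.2), (nth d p.2 m), (nth d p.2 m.+1), (drop m.+2 p.2).
  split; first exact: cut.
  by left; split=> //; rewrite {1}dm; apply: (other_nth plane pP).
have [lt_m|ge_m] := ltnP m (size p.2); last first.
  have em : m = size p.2 by apply/eqP; rewrite eqn_leq le_m.
  have n0 : 0 < size p.2 by rewrite -em.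
  by have := other_last plane pP d n0; rewrite -em -dm => ->; rewrite eqxx.
move=> _; case: m m0 lt_m dm {le_m} => // m _ lt_m dm.
exists (take m p.2), (nth d p.2 m), (nth d p.2 m.+1), (drop m.+2 p.2).
split; first exact: cut.
by right; split=> //; rewrite {1}dm; apply: (other_nth_opp plane pP).
Qed.

Lemma dart_at_vertex Z v : is_gpath Z -> v \in pverts Z -> Z.2 != [::] ->
  exists2 x, edge_on x Z & tail x = v.
Proof.
move=> zP /(nthP Z.1)[i lt_i <-] nz.
have d0 : D by case: (Z.2) nz.
have n0 : 0 < size Z.2 by case: (Z.2) nz.
move: lt_i; rewrite /= size_map ltnS leq_eqVlt => /orP[/eqP ->|lt_i]; last first.
  exists (nth d0 Z.2 i); first exact: (edge_on_nth plane).
  by rewrite (tail_nth zP).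
have lt_n : (size Z.2).-1 < size Z.2 by rewrite prednK.
exists (opp (nth d0 Z.2 (size Z.2).-1)).
  by rewrite (edge_on_opp plane) (edge_on_nth plane).
by have := dhead_nth tail opp (p := Z) d0 lt_n; rewrite prednK.
Qed.

Lemma edge_on_subpath Z p x : subpath Z p -> edge_on x Z -> edge_on x p.
Proof.
have mr s u : (u \in rev_opp opp s) = (opp u \in s).
  by rewrite /rev_opp mem_rev -{1}(oppK u) (mem_map opp_inj).
case/and3P=> _ _ /orP[] /mem_infix sub; rewrite /Defs.edge_on.
  by case/orP => /sub ->; rewrite ?orbT.
by case/orP => xz; apply/orP; [right|left]; apply: sub; rewrite [_ \in _]mr ?oppK.
Qed.

(** Two pairs of distinct darts that alternate around a vertex form a crossing whose common subpath
    is that single vertex. *)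
Lemma uncrossed_vertex p q d1 g1 :
  is_gpath p -> is_gpath q -> uncrossed tail opp rot p q ->
  edge_on d1 p -> edge_on g1 q -> tail d1 = tail g1 ->
  d1 != g1 -> other p d1 != g1 -> d1 != other q g1 -> other p d1 != other q g1 ->
  rotpos rot d1 < rotpos rot g1 < rotpos rot (other p d1) ->
  rotpos rot (other p d1) < rotpos rot (other q g1) -> False.
Proof.
move=> pP qP unc d1p g1q t n1 n2 n3 n4 /andP[l1 l2] l3; apply: unc.
have nd : other p d1 != d1 by apply: contraTneq l2 => ->; rewrite -leqNgt ltnW.
have ng : other q g1 != g1 by apply: contraTneq l3 => ->; rewrite -leqNgt ltnW.
have [a [e [e' [b [ep Hp]]]]] := chord_split pP d1p nd.
have [a' [g [g' [b' [eq Hq]]]]] := chord_split qP g1q ng.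
have te : dhead e = tail d1.
  by case: Hp => -[h1 h2]; rewrite /Defs.dhead -?h2 ?tail_other -?h1.
have te' : tail e' = tail d1.
  by case: Hp => -[h1 h2]; rewrite -?h2 ?tail_other ?h1.
have tg : dhead g = tail d1.
  by rewrite t; case: Hq => -[h1 h2]; rewrite /Defs.dhead -?h2 ?tail_other -?h1.
have tg' : tail g' = tail d1.
  by rewrite t; case: Hq => -[h1 h2]; rewrite -?h2 ?tail_other ?h1.
have ep0 : p.2 = a ++ e :: [::] ++ e' :: b by [].
have eq0 : q.2 = a' ++ g :: [::] ++ g' :: b' by [].
exists (dhead e, [::]); split.
- split; first by rewrite (subpath_middle pP ep0) te -tg (subpath_middle qP eq0).
  (* A common subpath with an edge through this vertex would have a dart here on both paths, but the
     two darts of [p] differ from the two of [q]. *)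
  move=> Z' zp zq zz; rewrite leqn0 size_eq0; apply: contraT => nz.
  have /and3P[zP _ _] := zp; have /and3P[_ vz _] := zz.
  have [x xz tx] := dart_at_vertex zP vz nz.
  have xp := edge_on_subpath zp xz; have xq := edge_on_subpath zq xz.
  rewrite /= te in tx.
  have xd : x = d1 \/ x = other p d1.
    have [->|nx] := eqVneq x d1; [by left | right].
    by rewrite (other_eq plane pP d1p xp).
  have xg : x = g1 \/ x = other q g1.
    have [->|nx] := eqVneq x g1; [by left | right].
    by rewrite (other_eq plane qP g1q xq) // tx.
  by case: xd => xd; case: xg => xg; move: n1 n2 n3 n4; rewrite -xd -xg eqxx.
- exact: no_endpoint_middle ep0.
- by rewrite te -tg; apply: no_endpoint_middle eq0.
exists a, e, e', b, a', g, g', b'; split=> //; first by left.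
  by rewrite te.
(* The ring is now the orbit starting at [e'], so indices are clockwise distances from [e'];
   alternation survives this cyclic shift of the positions. *)
rewrite /alternate /ring.
have mo x : tail x = tail d1 -> x \in orbit rot e'.
  by move=> tx; rewrite -fconnect_orbit; apply: (pe_fconnect plane); rewrite te'.
have io x : tail x = tail d1 -> index x (orbit rot e') = _ :=
  fun tx => findex_rpos plane (etrans te' (esym tx)).
have tx1 : tail (other p d1) = tail d1 by rewrite tail_other.
have tx2 : tail (other q g1) = tail d1 by rewrite tail_other.
have o1 := rpos_lt plane d1; have o2 := rpos_lt plane g1.
have o3 := rpos_lt plane (other p d1); have o4 := rpos_lt plane (other q g1).
rewrite !(order_tail plane tx1) !(order_tail plane tx2) -(order_tail plane t) in o2 o3 o4.
have oe := order_tail plane te'.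
rewrite !mo //= !io // oe.
by case: Hp => -[h1 h2]; case: Hq => -[h3 h4];
  rewrite -?h1 -?h2 -?h3 -?h4;
  move: l1 l2 l3 o1 o2 o3 o4; rewrite -?h1 -?h2 -?h3 -?h4; clear;
  do ?[case: ifP]; lia.
Qed.

End VertexCrossing.

(** * Left-to-right order of paths on a dart *)

Lemma prefix_split (T : eqType) (s t : seq T) :
  (exists c e b g b', [/\ s = c ++ e :: b, t = c ++ g :: b' & e != g]) \/
  (exists r, t = s ++ r) \/ (exists r, s = t ++ r).
Proof.
elim: s t => [|x s IHs] [|y t].
- by right; left; exists [::].
- by right; left; exists (y :: t).
- by right; right; exists (x :: s).
have [->|ne] := eqVneq x y; last by left; exists [::], x, s, y, t.
case: (IHs t) => [[c [e [b [g [b' [-> -> ne]]]]]]|[[r ->]|[r ->]]].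
- by left; exists (y :: c), e, b, g, b'.
- by right; left; exists r.
- by right; right; exists r.
Qed.

Section Family.
Variables (V D : finType) (tail : D -> V) (opp rot : D -> D).
Hypothesis plane : plane_embedding tail opp rot.
Let oppK := pe_oppK plane.
Let opp_inj := inv_inj oppK.
Notation is_gpath := (is_gpath tail opp).
Notation prev := (Defs.prev tail opp).
Notation edge_on := (edge_on opp).
Notation other := (other_dart tail opp).
Notation ropp := (rev_opp opp).

Variables (I : finType) (P : I -> gpath V D).
Hypothesis gP : forall i, is_gpath (P i).
Hypothesis unc : forall i j, i != j -> uncrossed tail opp rot (P i) (P j).
Hypothesis priv : forall i j d,
  edge_on d (P i) -> other (P i) d = d -> edge_on d (P j) -> j = i.

Definition wt (i : I) (d : D) : nat := weight tail opp rot (P i) #|D| d.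

(** Compare the two paths outwards from [d] in each direction. If one ended before they part, its
    end edge would lie on the other path, against [priv]. *)
Lemma share_split i j d q' : i != j -> q' = P j \/ q' = prev (P j) ->
  d \in (P i).2 -> d \in q'.2 ->
  exists a e c c' e' b a' g g' b',
    [/\ (P i).2 = (a ++ e :: c) ++ d :: c' ++ e' :: b,
        q'.2 = (a' ++ g :: c) ++ d :: c' ++ g' :: b', e != g & e' != g'].
Proof.
move=> nij qq' dp dq.
have q'P : is_gpath q' by case: qq' => ->//; apply: (is_gpath_prev plane).
have eq' x : edge_on x q' = edge_on x (P j).
  by case: qq' => ->//; apply: (edge_on_prev plane).
have oq' x : other q' x = other (P j) x.
  by case: qq' => ->//; apply: (other_prev plane).
have privp x : edge_on x (P i) -> other (P i) x = x -> edge_on x q' -> False.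
  by move=> xp ox; rewrite eq' => /(priv xp ox) ji; rewrite ji eqxx in nij.
have privq x : edge_on x q' -> other q' x = x -> edge_on x (P i) -> False.
  rewrite eq' oq' => xq ox /(priv xq ox) ij; by rewrite ij eqxx in nij.
have fwd (s : gpath V D) x : is_gpath s -> x \in s.2 ->
    [/\ edge_on (head x s.2) s, other s (head x s.2) = head x s.2,
        edge_on (opp (last x s.2)) s
      & other s (opp (last x s.2)) = opp (last x s.2)].
  move=> sP xs; have n0 : 0 < size s.2 by case: (s.2) xs.
  rewrite -nth0 -nth_last; split.
  - exact: (edge_on_nth plane).
  - exact: (other_first plane).
  - by rewrite (edge_on_opp plane) (edge_on_nth plane) // prednK.
  - exact: (other_last plane).
have [p1 [p2 ep]] : exists p1 p2, (P i).2 = p1 ++ d :: p2.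
  by case/splitPr: dp => p1 p2; exists p1, p2.
have [q1 [q2 eq]] : exists q1 q2, q'.2 = q1 ++ d :: q2.
  by case/splitPr: dq => q1 q2; exists q1, q2.
have [h1 h2 h3 h4] := fwd _ _ (gP i) dp; have [k1 k2 k3 k4] := fwd _ _ q'P dq.
have [|[[r er]|[r er]]] := prefix_split (rev p1) (rev q1); last 2 first.
- case: (privp _ h1 h2); rewrite ep; apply/orP; left.
  rewrite eq -(revK q1) er rev_cat revK -catA mem_cat.
  by apply/orP; right; case: (p1) => [|x s] /=; rewrite inE eqxx.
- case: (privq _ k1 k2); rewrite eq; apply/orP; left.
  rewrite ep -(revK p1) er rev_cat revK -catA mem_cat.
  by apply/orP; right; case: (q1) => [|x s] /=; rewrite inE eqxx.
move=> [c [e [a [g [a' [e1 e2 ne]]]]]].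
have {}e1 : p1 = rev a ++ e :: rev c
  by rewrite -(revK p1) e1 rev_cat rev_cons cat_rcons.
have {}e2 : q1 = rev a' ++ g :: rev c
  by rewrite -(revK q1) e2 rev_cat rev_cons cat_rcons.
have [|[[r er]|[r er]]] := prefix_split p2 q2; last 2 first.
- case: (privp _ h3 h4); rewrite (edge_on_opp plane) ep last_cat /=; apply/orP;
  left.
  by rewrite eq er -cat_cons catA mem_cat mem_cat mem_last orbT.
- case: (privq _ k3 k4); rewrite (edge_on_opp plane) eq last_cat /=; apply/orP;
  left.
  by rewrite ep er -cat_cons catA mem_cat mem_cat mem_last orbT.
move=> [c' [e' [b [g' [b' [e3 e4 ne']]]]]].
exists (rev a), e, (rev c), c', e', b, (rev a'), g, g', b'.
by rewrite -e1 -e2 -e3 -e4.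
Qed.

Lemma ropp_cons x s : ropp (x :: s) = rcons (ropp s) (opp x).
Proof. by rewrite /rev_opp /= rev_cons. Qed.

(** The weights on [d] see the parting behind [d], those on [opp d] the parting ahead, and
    [uncrossed_middle] relates the two. Clockwise is opposite as seen from the two ends of an edge,
    so opposite comparisons mean the same left-to-right order. *)
Lemma order_reversal_fwd i j d : i != j -> d \in (P i).2 -> edge_on d (P j) ->
  [/\ diverge tail opp (P i) (P j) #|D| d, diverge tail opp (P i) (P j) #|D| (opp d)
    & (wt i d < wt j d) = (wt j (opp d) < wt i (opp d))].
Proof.
move=> nij dp dq.
have [q' qq' dq'] : exists2 q', q' = P j \/ q' = prev (P j) & d \in q'.2.
  case/orP: dq => dq; first by exists (P j); [left|].
  exists (prev (P j)); first by right.
  by rewrite /= mem_rev -(oppK d) (mem_map opp_inj).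
have q'P : is_gpath q' by case: qq' => ->//; apply: (is_gpath_prev plane).
have wq' k x : weight tail opp rot q' k x = weight tail opp rot (P j) k x.
  by case: qq' => ->//; apply: (weight_prev plane).
have dvq' k x : diverge tail opp (P i) q' k x = diverge tail opp (P i) (P j) k x.
  by case: qq' => ->//; rewrite (diverge_prev plane).
have [a [e [c [c' [e' [b [a' [g [g' [b' [ep eq ne ne']]]]]]]]]]] :=
  share_split nij qq' dp dq'.
(* A path has distinct darts, so [#|D|] digits reach past the common stretch in both directions. *)
have sz : size (P i).2 <= #|D|.
  by rewrite -(card_uniqP (uniq_darts (gP i))) max_card.
have szp := sz; rewrite ep !size_cat /= size_cat /= in szp.
have lts x y z w u : x + y.+1 + (z + w.+1).+1 <= u -> y < u /\ z < u by lia.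
have [ltc ltc1] := lts _ _ _ _ _ szp.
have ltc' : size (ropp c') < #|D| by rewrite size_rev size_map.
have [dv1 lt1] := weight_back plane (gP i) q'P ep eq ne ltc.
have ep' : (prev (P i)).2 = (ropp b ++ opp e' :: ropp c') ++ opp d :: ropp (a ++ e :: c).
  by rewrite -[LHS]/(ropp (P i).2) ep ropp_cat ropp_cons ropp_cat ropp_cons !cat_rcons.
have eq' : (prev q').2 = (ropp b' ++ opp g' :: ropp c') ++ opp d :: ropp (a' ++ g :: c).
  by rewrite -[LHS]/(ropp q'.2) eq ropp_cat ropp_cons ropp_cat ropp_cons !cat_rcons.
have one' : opp g' != opp e' by rewrite (inj_eq opp_inj) eq_sym.
have [dv2 lt2] := weight_back plane (is_gpath_prev plane q'P)
  (is_gpath_prev plane (gP i)) eq' ep' one' ltc'.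
rewrite !(weight_prev plane) !wq' !oppK in lt1 lt2.
rewrite !(diverge_prev plane) !dvq' in dv1 dv2.
split.
- exact: diverge_leq dv1.
- rewrite diverge_sym dvq' in dv2.
  exact: diverge_leq dv2.
rewrite /wt lt1 lt2.
have hd : head (opp d) (ropp c') = opp (last d c').
  by case/lastP: (c') => [|s x] //; rewrite last_rcons /rev_opp map_rcons rev_rcons.
have z : exists z, c ++ d :: c' = head d c :: z /\ last (head d c) z = last d c'.
  case: (c) => [|x s] /=; first by exists c'.
  by exists (s ++ d :: c'); rewrite last_cat.
have [zz [ez lz]] := z.
rewrite hd -lz; apply: (uncrossed_middle plane (gP i) (gP j) qq' _ _ ne ne' (unc nij)).
  by rewrite ep -ez -!catA.
by rewrite eq -ez -!catA.
Qed.

Lemma order_reversal i j d : i != j -> edge_on d (P i) -> edge_on d (P j) ->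
  diverge tail opp (P i) (P j) #|D| d /\
  (wt i d < wt j d) = (wt j (opp d) < wt i (opp d)).
Proof.
move=> nij /orP[dp|odp] dq; first by case: (order_reversal_fwd nij dp dq).
rewrite -(edge_on_opp plane) in dq.
have [dv1 dv2 rv] := order_reversal_fwd nij odp dq.
rewrite oppK in dv2 rv; split=> //.
have := weight_neq plane dv1; have := weight_neq plane dv2.
rewrite -/(wt i d) -/(wt j d) -/(wt i (opp d)) -/(wt j (opp d)).
by move: rv; lia.
Qed.

Lemma wt_neq i j d : i != j -> edge_on d (P i) -> edge_on d (P j) -> wt i d != wt j d.
Proof.
by move=> nij dp dq; case: (order_reversal nij dp dq) => /(weight_neq plane).
Qed.

(** With equal turns the leading digits cancel and the comparison moves to [opp (other (P i) d)];
    [order_reversal] carries it across that edge. *)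
Lemma wt_together i j d : i != j -> edge_on d (P i) -> edge_on d (P j) ->
  other (P i) d = other (P j) d ->
  (wt i d < wt j d) = (wt j (other (P i) d) < wt i (other (P i) d)).
Proof.
move=> nij dp dq e.
have [dv _] := order_reversal nij dp dq.
have op := edge_on_other tail dp; have oq := edge_on_other tail dq.
rewrite -e in oq.
have [_ rv] := order_reversal nij op oq.
have [n eD] : exists n, #|D| = n.+1 by exists #|D|.-1; rewrite prednK //;
  apply/card_gt0P; exists d.
have nji : j != i by rewrite eq_sym.
have [_ ->] := order_reversal nji oq op.
rewrite /wt in dv *; rewrite eD in dv *.
rewrite weight_together //.
rewrite /= e eqxx /= in dv; rewrite e.
by rewrite (weight_fuel plane dv).
Qed.

Lemma wt_parted i j d : edge_on d (P i) ->
  other (P i) d != other (P j) d ->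
  (wt i d < wt j d) =
    (findex rot d (other (P j) d) < findex rot d (other (P i) d)).
Proof.
move=> dp ne.
have [n eD] : exists n, #|D| = n.+1 by exists #|D|.-1; rewrite prednK //;
  apply/card_gt0P; exists d.
by rewrite /wt eD weight_parted.
Qed.

End Family.

(** * Noncrossing chords and face counting *)

Section CyclicOrder.
Variables (X V : finType) (tl : X -> V) (key : X -> nat).
Hypothesis key_inj : forall x y, tl x = tl y -> key x = key y -> x = y.

Definition cycsucc (x : X) : X :=
  if [exists y, (tl y == tl x) && (key x < key y)]
  then odflt x [pick y | [&& tl y == tl x, key x < key y &
    [forall z, (tl z == tl x) && (key x < key z) ==> (key y <= key z)]]]
  else odflt x [pick y | (tl y == tl x) &&
    [forall z, (tl z == tl x) ==> (key y <= key z)]].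

Variant cycsucc_spec x y : Prop :=
| CycNext of tl y = tl x & key x < key y &
    (forall z, tl z = tl x -> key x < key z -> key y <= key z)
| CycWrap of tl y = tl x & (forall z, tl z = tl x -> key z <= key x) &
    (forall z, tl z = tl x -> key y <= key z).

Lemma cycsuccP x : cycsucc_spec x (cycsucc x).
Proof.
rewrite /cycsucc; case: ifP => [/existsP[y0 Py0]|/negbT/existsPn no].
  case: pickP => [y /and3P[/eqP ty lt /forallP h]|none] /=.
    left=> // z tz ltz; have := h z; rewrite tz eqxx ltz; exact.
  pose Q y := (tl y == tl x) && (key x < key y).
  case: (arg_minnP (P := Q) key Py0) => y Qy miny.
  case/negP: (negbT (none y)); case/andP: (Qy) => -> -> /=.
  by apply/forallP=> z; apply/implyP; apply: miny.
have mx z : tl z = tl x -> key z <= key x.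
  by move=> tz; have := no z; rewrite tz eqxx /= -leqNgt.
case: pickP => [y /andP[/eqP ty /forallP h]|none] /=.
  right=> // z tz; have := h z; rewrite tz eqxx; exact.
pose Q y := tl y == tl x; have Qx : Q x by apply: eqxx.
case: (arg_minnP (P := Q) key Qx) => y Qy miny.
case/negP: (negbT (none y)); rewrite [_ == _]Qy /=.
by apply/forallP=> z; apply/implyP; apply: miny.
Qed.

Lemma tl_cycsucc x : tl (cycsucc x) = tl x.
Proof. by case: (cycsuccP x). Qed.

Lemma cycsucc_inj : injective cycsucc.
Proof.
move=> x x' e; have t : tl x = tl x' by rewrite -tl_cycsucc e tl_cycsucc.
have t' := esym t.
case: (cycsuccP x) (cycsuccP x') => [_ l1 m1|_ l1 m1] [_ l2 m2|_ l2 m2];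
  rewrite -e in l2 m2; apply: key_inj => //.
- by have := m1 x' t'; have := m2 x t; move: l1 l2; lia.
- by have := m2 x t; lia.
- by have := m1 x' t'; lia.
- by have := l1 x' t'; have := l2 x t; lia.
Qed.

Definition succp : {perm X} := perm cycsucc_inj.

Variable pi : {perm X}.
Hypothesis piK : forall x, pi (pi x) = x.
Hypothesis tl_pi : forall x, tl (pi x) = tl x.
Hypothesis noncrossing : forall x y, tl x = tl y ->
  key x < key y < key (pi x) -> key (pi x) < key (pi y) -> False.

(** The chords that span the gap just before [x], each represented by its upper end. *)
Let cover x := [set b | (tl b == tl x) && (key (pi b) < key x <= key b)].

Lemma cover_succ y :
  cover (cycsucc y) = [set b | (tl b == tl y) && (key (pi b) <= key y < key b)].
Proof.
apply/setP=> b; rewrite !inE tl_cycsucc; have [tb /=|//] := eqVneq (tl b) (tl y).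
have tp : tl (pi b) = tl y by rewrite tl_pi.
case: (cycsuccP y) => [_ l m|_ l m].
  have := m b tb; have := m (pi b) tp; move: l; lia.
have := l b tb; have := l (pi b) tp; have := m (pi b) tp; lia.
Qed.

(** The gap before [x] and the gap after [pi x] lie on the same side of the chord joining [x] and
    [pi x]. A chord spanning only one of them would cross it. *)
Lemma cover_invariant x : cover (cycsucc (pi x)) = cover x.
Proof.
rewrite cover_succ; apply/setP=> b; rewrite !inE tl_pi.
have [tb /=|//] := eqVneq (tl b) (tl x).
have [->|nbx] := eqVneq b x; first by rewrite !leqnn andbT.
have [->|nbp] := eqVneq b (pi x); first by rewrite piK !ltnn andbF.
have kn u v : tl u = tl v -> u != v -> key u != key v.
  by move=> t; apply: contraNneq => /(key_inj t) ->.
have n1 := kn _ _ tb nbx.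
have n2 : key b != key (pi x) by apply: kn; rewrite ?tl_pi.
have n3 : key (pi b) != key x.
  by apply: kn; rewrite ?tl_pi //; apply: contraNneq nbp => <-; rewrite piK.
have n4 : key (pi b) != key (pi x).
  by apply: kn; rewrite ?tl_pi // (inj_eq perm_inj).
have c1 := @noncrossing (pi b) x; have c2 := @noncrossing (pi b) (pi x).
have c3 := @noncrossing x (pi b); have c4 := @noncrossing (pi x) (pi b).
rewrite !piK !tl_pi in c1 c2 c3 c4.
move: (c1 tb) (c2 tb) (c3 (esym tb)) (c4 (esym tb)) n1 n2 n3 n4; lia.
Qed.

(* A noncrossing family of chords cuts the discs at the vertices into
   (number of vertices) + (number of chords) regions. *)
Lemma ncyc_regions :
  #|tl @: [set: X]| + #|[set x | key (pi x) < key x]| <= ncyc (pi * succp)%g.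
Proof.
(* Each vertex has a region spanned by no chord, and each chord a region just before its upper end
   [b]. As [b] has the least key in [cover b], these labels are distinct. *)
pose label x := (tl x, cover x).
have inv x : label ((pi * succp)%g x) = label x.
  by rewrite permM [succp _]permE /label cover_invariant tl_cycsucc tl_pi.
apply: leq_trans (leq_card_invariant inv).
set tops := [set x | _].
have self b : b \in tops -> b \in cover b.
  by rewrite !inE eqxx leqnn andbT.
pose A := (fun v => (v, set0 : {set X})) @: (tl @: [set: X]).
have -> : #|tl @: [set: X]| = #|A| by rewrite [RHS]card_imset // => u v [].
have -> : #|tops| = #|label @: tops|.
  rewrite [RHS]card_in_imset // => b b' bt b't [tb cb].
  apply: key_inj => //; apply/eqP; rewrite eqn_leq.
  have := self _ bt; rewrite cb inE => /andP[_ /andP[_ ->]].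
  by have := self _ b't; rewrite -cb inE => /andP[_ /andP[_ ->]].
have dis : [disjoint A & label @: tops].
  apply/pred0P => l /=;
    apply/negbTE/negP => /andP[/imsetP[v _ ->] /imsetP[b bt [_ e]]].
  by have := self _ bt; rewrite -e inE.
have /eqP <- : #|A :|: label @: tops| == #|A| + #|label @: tops|.
  by have [_ ->] := leq_card_setU A (label @: tops).
apply: subset_leq_card; rewrite subUset; apply/andP; split; apply/subsetP => l.
  case/imsetP=> _ /imsetP[x _ ->] ->.
  pose Q y := tl y == tl x; have Qx : Q x by apply: eqxx.
  case: (arg_minnP (P := Q) key Qx) => y /eqP ty miny.
  apply/imsetP; exists y => //; rewrite /label ty; congr pair.
  apply/esym/setP => b; rewrite !inE;
    apply/negbTE/negP => /andP[/eqP tb /andP[lt _]].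
  have /miny : Q (pi b) by rewrite /Q tl_pi tb ty.
  by rewrite leqNgt lt.
by case/imsetP=> b _ ->; apply: imset_f.
Qed.

Lemma card_chords :
  #|X| <= 2 * #|[set x | key (pi x) < key x]| + #|[set x | pi x == x]|.
Proof.
set tops := [set x | _]; set fx := [set x | _].
have -> : 2 * #|tops| = #|tops| + #|pi @: tops|.
  by rewrite card_imset ?mul2n ?addnn //; apply: perm_inj.
have [le _] := leq_card_setU tops (pi @: tops).
have [le' _] := leq_card_setU (tops :|: pi @: tops) fx.
apply: leq_trans (_ : #|tops :|: pi @: tops :|: fx| <= _); last first.
  by apply: leq_trans le' _; rewrite leq_add2r.
rewrite -cardsT; apply: subset_leq_card; apply/subsetP => x _; rewrite !inE.
have [|nf] := eqVneq (pi x) x; first by rewrite !orbT.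
have [//|lt|e] := ltngtP (key (pi x)) (key x).
  rewrite -{1}(piK x) imset_f ?orbT //.
  by rewrite inE piK.
by rewrite (key_inj (tl_pi x) e) eqxx in nf.
Qed.

End CyclicOrder.

(** * Faces of the contact graph *)

Section FaceCount.
Variables (X I : finType) (g : X -> I) (th : X -> X) (eps : X -> X).
Variable psi : {perm X}.
Hypothesis psiE : forall x, psi x = th (eps x).
Hypothesis g_th : forall x, g (th x) = g x.
Hypothesis th_trans : forall x y, g x = g y -> exists k, iter k th x = y.
Let M := [set x | eps x != x].
Hypothesis eps_other : forall x, x \in M -> g (eps x) != g x.
Hypothesis eps_simple : forall x y, x \in M -> y \in M ->
  g x = g (eps y) -> g y = g (eps x) -> y = x \/ y = eps x.

Let full (O : {set X}) := [exists x, [set y | g y == g x] \subset O].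

Lemma fullI x y0 : (forall k, iter k th y0 \in porbit psi x) -> full (porbit psi x).
Proof.
move=> h; apply/existsP; exists y0; apply/subsetP => y; rewrite inE => /eqP e.
by have [k <-] := th_trans (esym e).
Qed.

Lemma psi_notM x : x \notin M -> psi x = th x.
Proof. by rewrite inE negbK psiE => /eqP ->. Qed.

(** After the contact at [x] the walk follows the path of [eps x]. If it met no contact there except
    [eps x] itself, it would pass through all of that path, since the [th]-successor of [eps x] is
    [psi x]. *)
Lemma next_moved x : x \in M -> ~~ full (porbit psi x) ->
  exists x1, [/\ x1 \in M, x1 \in porbit psi x, g x1 = g (eps x) & x1 != eps x].
Proof.
move=> xM nf.
case: (pickP [pred x1 | [&& x1 \in M, x1 \in porbit psi x, g x1 == g (eps x) &
    x1 != eps x]]) => [x1 /and4P[m1 o1 /eqP g1 n1]|none]; first by exists x1.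
case/negP: nf; apply: (@fullI _ (th (eps x))) => k.
have y1 : th (eps x) \in porbit psi x by rewrite -psiE -porbit_step porbit_id.
have gk n : g (iter n th (th (eps x))) = g (eps x).
  by elim: n => [|n IHn] /=; rewrite g_th.
elim: k => [//|k IHk] /=; set y := iter k _ _ in IHk *.
have [yM|yM] := boolP (y \in M); last first.
  by rewrite -psi_notM // -eq_porbit_mem porbit_step eq_porbit_mem.
have := none y; rewrite /= yM IHk gk eqxx /= => /negbFE/eqP ->.
exact: y1.
Qed.

(** Each contact leads to a next one on the other path. If the second step led back to [x0], then
    [x0] and [x1] would be different contacts of the same two paths, against [eps_simple]. *)
Lemma face_large x : ~~ full (porbit psi x) ->
  3 <= #|[set y in M | porbit psi y == porbit psi x]|.
Proof.
move=> nf.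
have [x0 x0M x0O] : exists2 x0, x0 \in M & x0 \in porbit psi x.
  case: (pickP [pred x0 | (x0 \in M) && (x0 \in porbit psi x)]) => [x0 /andP[]|none].
    by exists x0.
  case/negP: nf; apply: (@fullI _ x) => k; elim: k => [|k IHk];
    first exact: porbit_id.
  rewrite iterS -psi_notM; last by have := none (iter k th x);
    rewrite /= IHk andbT => ->.
  by rewrite -eq_porbit_mem porbit_step eq_porbit_mem.
have e0 : porbit psi x0 = porbit psi x by apply/eqP; rewrite eq_porbit_mem.
have nf0 : ~~ full (porbit psi x0) by rewrite e0.
have [x1 [m1 o1 g1 n1]] := next_moved x0M nf0.
have e1 : porbit psi x1 = porbit psi x by apply/eqP; rewrite eq_porbit_mem -e0.
have nf1 : ~~ full (porbit psi x1) by rewrite e1.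
have [x2 [m2 o2 g2 n2]] := next_moved m1 nf1.
have e2 : porbit psi x2 = porbit psi x by apply/eqP; rewrite eq_porbit_mem -e1.
have d01 : x0 != x1 by apply: contraTneq (eps_other x0M) => e; rewrite -g1 e eqxx.
have d12 : x1 != x2 by apply: contraTneq (eps_other m1) => e; rewrite -g2 e eqxx.
have d02 : x0 != x2.
  apply/eqP => e; rewrite -e in g2.
  case: (eps_simple x0M m1 g2 g1) => h; first by rewrite h eqxx in d01.
  by rewrite h eqxx in n1.
have <- : #|[set x0; x1; x2]| = 3.
  rewrite setUC cardsU1 !inE cards2 d01 [x2 == _]eq_sym [x2 == x1]eq_sym.
  by rewrite (negPf d02) (negPf d12).
apply: subset_leq_card; apply/subsetP => y; rewrite !inE -orbA.
rewrite !inE in x0M m1 m2.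
by case/or3P => /eqP ->; rewrite ?e0 ?e1 ?e2 eqxx andbT.
Qed.

(** A path is contained in at most one cycle, so at most [#|I|] cycles are full; each of the others
    contains three elements of [M]. *)
Lemma ncyc_faces : 3 * ncyc psi <= 3 * #|I| + #|M|.
Proof.
pose Big := [set O in porbits psi | ~~ full O].
pose Full := [set O in porbits psi | full O].
have cF : #|Full| <= #|I|.
  pose h i := if [pick x | g x == i] is Some x then porbit psi x else set0.
  apply: leq_trans (leq_imset_card h I); apply: subset_leq_card.
  apply/subsetP => O; rewrite inE => /andP[/imsetP[x0 _ ->] /existsP[x sub]].
  apply/imsetP; exists (g x) => //; rewrite /h; case: pickP => [y gy|/(_ x)].
    by apply/esym/eqP; rewrite eq_porbit_mem; apply: (subsetP sub); rewrite inE.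
  by rewrite eqxx.
have cB : 3 * #|Big| <= #|M|.
  have -> : #|M| = \sum_(x in M) 1 by rewrite sum1_card.
  rewrite (partition_big (porbit psi) (mem (porbits psi))) /=; last first.
    by move=> x _; apply: imset_f.
  rewrite mulnC -sum_nat_const.
  apply: (@leq_trans (\sum_(O in Big) \sum_(x in M | porbit psi x == O) 1)).
    apply: leq_sum => O; rewrite inE => /andP[/imsetP[x _ ->] nf].
    by rewrite sum1dep_card; apply: face_large.
  rewrite [X in _ <= X](bigID full) /=.
  rewrite [X in _ <= _ + X](eq_bigl (fun O => O \in Big)); first
    by rewrite leq_addl.
  by move=> O; rewrite [in RHS]inE.
have -> : ncyc psi = #|Full| + #|Big|.
  rewrite /ncyc -(cardsID [set O | full O] (porbits psi)); congr (_ + _).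
    by apply: eq_card => O; rewrite !inE.
  by apply: eq_card => O; rewrite !inE andbC.
by move: cF cB; set a := #|Full|; set b := #|Big|; set c := #|M|; set d := #|I|;
  lia.
Qed.

End FaceCount.

(** * Contacts between paths with private end edges *)

Section Contacts.
Variables (V D : finType) (tail : D -> V) (opp rot : D -> D).
Hypothesis plane : plane_embedding tail opp rot.
Let oppK := pe_oppK plane.
Notation is_gpath := (is_gpath tail opp).
Notation edge_on := (edge_on opp).
Notation other := (other_dart tail opp).
Notation rpos := (rotpos rot).

Variables (I : finType) (P : I -> gpath V D).
Hypothesis gP : forall i, is_gpath (P i).
Hypothesis unc : forall i j, i != j -> uncrossed tail opp rot (P i) (P j).
Hypothesis priv : forall i j d,
  edge_on d (P i) -> other (P i) d = d -> edge_on d (P j) -> j = i.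
Notation wt := (wt tail opp rot P).

Let X : finType := {x : I * D | edge_on x.2 (P x.1)}.
Let ix (x : X) : I := (val x).1.
Let dx (x : X) : D := (val x).2.
Let mk i d (h : edge_on d (P i)) : X := exist _ (i, d) h.

Let xP (x : X) : edge_on (dx x) (P (ix x)). Proof. exact: (valP x). Qed.

Let xext (x y : X) : ix x = ix y -> dx x = dx y -> x = y.
Proof.
by move=> e1 e2; apply: val_inj; move: e1 e2; rewrite /ix /dx;
  case: (val x) (val y) => [? ?] [? ?] /= -> ->.
Qed.

Let oxP (x : X) : edge_on (opp (dx x)) (P (ix x)).
Proof. by rewrite (edge_on_opp plane). Qed.

Let alf (x : X) : X := mk (oxP x).
Let pif (x : X) : X := mk (edge_on_other tail (xP x)).

Let alfK : involutive alf.
Proof. by move=> x; apply: xext; last exact: oppK. Qed.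
Let pifK : involutive pif.
Proof. by move=> x; apply: xext; last exact: (otherK plane (gP _) (xP x)). Qed.

Let alp : {perm X} := perm (inv_inj alfK).
Let pip : {perm X} := perm (inv_inj pifK).

Let tl (x : X) : V := tail (dx x).
Let base : nat := #|D|.+1 ^ #|D|.
(* Lexicographic, so that increasing keys list the copies of the darts at a
   vertex clockwise. *)
Let key (x : X) : nat := rpos (dx x) * base + wt (ix x) (dx x).

Let wt_lt i d : wt i d < base. Proof. exact: weight_lt. Qed.

Let key_rpos x y : key x < key y -> rpos (dx x) <= rpos (dx y).
Proof.
move=> k; rewrite leqNgt; apply/negP => lt; move: k; rewrite /key.
have : (rpos (dx y)).+1 * base <= rpos (dx x) * base by apply: leq_mul.
by rewrite mulSn; have := wt_lt (ix y) (dx y); lia.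
Qed.

Let rpos_key x y : rpos (dx x) < rpos (dx y) -> key x < key y.
Proof.
move=> lt; have : (rpos (dx x)).+1 * base <= rpos (dx y) * base by apply: leq_mul.
by rewrite mulSn /key; have := wt_lt (ix x) (dx x); lia.
Qed.

Let key_same x y : dx x = dx y ->
  (key x < key y) = (wt (ix x) (dx x) < wt (ix y) (dx x)).
Proof. by move=> e; rewrite /key -e ltn_add2l. Qed.

Let wt_inj i j d : edge_on d (P i) -> edge_on d (P j) -> wt i d = wt j d -> i = j.
Proof.
move=> di dj /eqP; apply: contraTeq => nij.
exact: (wt_neq plane gP unc priv).
Qed.

Let key_inj x y : tl x = tl y -> key x = key y -> x = y.
Proof.
move=> t e.
have er : rpos (dx x) = rpos (dx y).
  by have [/rpos_key|/rpos_key|//] := ltngtP (rpos (dx x)) (rpos (dx y));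
    rewrite e ltnn.
have ed := rpos_inj plane t er; apply: xext => //.
apply: (@wt_inj _ _ (dx x)); rewrite ?xP //; first by rewrite ed xP.
by move: e; rewrite /key -ed => /addnI.
Qed.

Let sg : {perm X} := succp key_inj.

(** The cases follow the coincidences among the four darts. If both are shared, [wt_together]
    forbids the order; if one is, [wt_parted] makes the order of the two copies on it agree with the
    positions of the remaining darts; if none, [uncrossed_vertex] applies. *)
Let noncrossing x y : tl x = tl y ->
  key x < key y < key (pip x) -> key (pip x) < key (pip y) -> False.
Proof.
have pE z : pip z = pif z by rewrite permE.
rewrite !pE => t /andP[k1 k2] k3.
set i := ix x; set j := ix y.
set d1 := dx x; set g1 := dx y; set d2 := dx (pif x); set g2 := dx (pif y).
have d2E : d2 = other (P i) d1 by [].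
have g2E : g2 = other (P j) g1 by [].
have d1P : edge_on d1 (P i) := xP x.
have g1P : edge_on g1 (P j) := xP y.
have d2P : edge_on d2 (P i) := xP (pif x).
have g2P : edge_on g2 (P j) := xP (pif y).
have td2 : tail d2 = tail d1 by rewrite d2E tail_other.
have tg2 : tail g2 = tail g1 by rewrite g2E tail_other.
have tg1 : tail g1 = tail d1 by rewrite -[LHS]t.
have ne_key z z' : key z < key z' -> z = z' -> False by move=> lt e;
  rewrite e ltnn in lt.
have nij : i != j.
  apply/eqP => eij.
  have [e|ne] := eqVneq g1 d1; first by apply: (ne_key _ _ k1); apply: xext.
  apply: (ne_key _ _ k2); apply: xext => //=.
  rewrite -/d1 -/g1 -/i; apply/esym; apply: (other_eq plane) => //.
  by rewrite [ix x]eij.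
have r1 := key_rpos k1; have r2 := key_rpos k2; have r3 := key_rpos k3.
rewrite -/d1 -/d2 -/g1 -/g2 in r1 r2 r3.
have nd : d1 != d2.
  by apply/eqP => e; apply: (ne_key _ _ (ltn_trans k1 k2)); apply: xext.
have ng : g1 != g2.
  by apply/eqP => e; apply: (ne_key _ _ (ltn_trans k2 k3)); apply: xext.
have ne_rpos a b : tail a = tail b -> a != b -> rpos a != rpos b.
  by move=> tab; apply: contraNneq => /(rpos_inj plane tab) ->.
have rd : rpos d1 != rpos d2 by apply: ne_rpos.
have rg : rpos g1 != rpos g2 by apply: ne_rpos.
have o1 := rpos_lt plane d1.
have o2 : rpos d2 < fingraph.order rot d1
  by rewrite -(order_tail plane td2) (rpos_lt plane).
have o3 : rpos g1 < fingraph.order rot d1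
  by rewrite -(order_tail plane tg1) (rpos_lt plane).
have o4 : rpos g2 < fingraph.order rot d1.
  by rewrite -(order_tail plane tg1) -(order_tail plane tg2) (rpos_lt plane).
have fx a b : tail a = tail d1 -> tail b = tail d1 -> findex rot a b =
    if rpos a <= rpos b then rpos b - rpos a
    else rpos b + fingraph.order rot d1 - rpos a.
  by move=> ta tb; rewrite (findex_rpos plane) ?ta ?tb // (order_tail plane ta).
have oK : other (P i) d2 = d1 by rewrite d2E; apply: (otherK plane).
have oK' : other (P j) g2 = g1 by rewrite g2E; apply: (otherK plane).
have tg2' : tail g2 = tail d1 by rewrite tg2.
have [e1|n1] := eqVneq d1 g1.
  rewrite key_same // -/d1 -/i -/j in k1.
  have g1P' : edge_on d1 (P j) by rewrite e1.
  have oj : other (P j) d1 = g2 by rewrite e1.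
  have [e2|n2] := eqVneq d2 g2.
    rewrite key_same // -/d2 -[ix (pif x)]/i -[ix (pif y)]/j in k3.
    have := wt_together plane gP unc priv nij d1P g1P'.
    by rewrite -d2E oj => /(_ e2); rewrite k1; move: k3; clear; lia.
  have := @wt_parted _ _ _ _ _ plane _ P i j d1 d1P.
  rewrite -d2E oj => /(_ n2); rewrite k1 !fx //.
  by case: ifP; case: ifP; move: r1 r2 r3 rd rg; rewrite -?e1; clear; lia.
have n1r : rpos d1 != rpos g1 by apply: ne_rpos.
have [e2|n2] := eqVneq g1 d2.
  rewrite key_same // -/g1 -[ix (pif x)]/i -/j in k2.
  have dg : d1 != g2 by apply/eqP => e; move: r1 r2 r3 n1r rg; rewrite -e; clear;
    lia.
  have := @wt_parted _ _ _ _ _ plane _ P j i g1 g1P.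
  have oi : other (P i) g1 = d1 by rewrite e2.
  rewrite -g2E oi eq_sym => /(_ dg); rewrite k2 !fx //.
  by case: ifP; case: ifP; move: r1 r2 r3 rd rg o1 o2 o3 o4 n1r; rewrite -?e2;
    clear; lia.
have n2r : rpos g1 != rpos d2 by apply: ne_rpos; rewrite ?td2.
have [e3|n3] := eqVneq d2 g2.
  rewrite key_same // -/d2 -[ix (pif x)]/i -[ix (pif y)]/j in k3.
  have := @wt_parted _ _ _ _ _ plane _ P i j d2 d2P.
  have oj : other (P j) d2 = g1 by rewrite e3.
  rewrite oK oj => /(_ n1); rewrite k3 !fx //.
  by case: ifP; case: ifP; move: r1 r2 r3 rd rg o1 o2 o3 o4 n1r n2r; clear; lia.
have n3r : rpos d2 != rpos g2 by apply: ne_rpos; rewrite ?td2.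
apply: (uncrossed_vertex plane (gP i) (gP j) (unc nij) d1P g1P) => //.
- by rewrite -d2E eq_sym.
- by rewrite -g2E; apply/eqP => e; move: r1 r2 r3 n1r rg; rewrite -e; clear; lia.
- by rewrite -d2E; move: r1 r2 n1r n2r; clear; lia.
by rewrite -d2E -g2E; move: r3 n3r; clear; lia.
Qed.

(* The side of [x] is a digon: a parallel copy follows [alf x] clockwise. *)
Let dig (x : X) : bool :=
  [exists y, (dx y == opp (dx x)) && (wt (ix x) (opp (dx x)) < wt (ix y) (opp (dx x)))].

(** The face permutation [al * sg] of the map whose edges have been replaced by parallel copies. *)
Let phi (x : X) : X := cycsucc tl key (alf x).

Let rev_wt i j d : edge_on d (P i) -> edge_on d (P j) -> wt i d < wt j d ->
  wt j (opp d) < wt i (opp d).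
Proof.
move=> di dj lt; have nij : i != j by apply: contraTneq lt => ->; rewrite ltnn.
by have [_ <-] := order_reversal plane gP unc priv nij di dj.
Qed.

Let phi_digE x : dig x ->
  [/\ dx (phi x) = opp (dx x),
      wt (ix x) (opp (dx x)) < wt (ix (phi x)) (opp (dx x))
    & forall l, edge_on (dx x) (P l) -> wt (ix x) (opp (dx x)) < wt l (opp (dx x)) ->
        wt (ix (phi x)) (opp (dx x)) <= wt l (opp (dx x))].
Proof.
case/existsP=> y /andP[/eqP dy lty].
have ky : key (alf x) < key y by rewrite key_same // dy.
have ty : tl y = tl (alf x) by rewrite /tl dy.
rewrite /phi; case: (cycsuccP tl key (alf x)) => [tz kz mz|_ /(_ y ty)]; last first.
  by rewrite leqNgt ky.
set z := cycsucc _ _ _ in tz kz mz *.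
have dz : dx z = opp (dx x).
  have r1 := key_rpos kz.
  have r2 : rpos (dx z) <= rpos (dx y).
    have := mz y ty ky; rewrite leq_eqVlt => /orP[/eqP e|/key_rpos //].
    by rewrite (key_inj _ e) // tz ty.
  rewrite dy in r2; apply: (rpos_inj plane); first exact: tz.
  by apply/eqP; rewrite eqn_leq r2.
split=> //; first by move: kz; rewrite key_same.
move=> l lP ltl; have lP' : edge_on (opp (dx x)) (P l)
  by rewrite (edge_on_opp plane).
have := mz (mk lP') erefl; rewrite key_same // => /(_ ltl).
by rewrite /key dz leq_add2l.
Qed.

(** Copies appear in opposite orders on a dart and on its reverse, so two neighbouring copies bound
    a face of length two. *)
Let phi_dig x : dig x -> dig (phi x) /\ phi (phi x) = x.
Proof.
move=> gx; have [dz kz mz] := phi_digE gx; set z := phi x in dz kz mz *.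
have zP : edge_on (opp (dx x)) (P (ix z)) by rewrite -dz xP.
have zP' : edge_on (dx x) (P (ix z)) by rewrite -(edge_on_opp plane).
have lt : wt (ix z) (dx x) < wt (ix x) (dx x).
  by have := rev_wt (oxP x) zP kz; rewrite oppK.
have gz : dig z by apply/existsP; exists x; rewrite dz oppK eqxx.
split=> //; have [dt kt mt] := phi_digE gz; set t := phi z in dt kt mt *.
rewrite dz oppK in dt kt mt.
have tP : edge_on (dx x) (P (ix t)) by rewrite -dt xP.
apply: xext => //; have xz : edge_on (opp (dx x)) (P (ix x)) := oxP x.
have := mt _ xz lt; rewrite leq_eqVlt => /orP[/eqP|ltx]; first exact: wt_inj.
have := rev_wt zP' tP kt; rewrite ltnNge mz //; exact: rev_wt.
Qed.

Let phi_nodig x : ~~ dig x -> ~~ dig (phi x).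
Proof.
move=> nx; apply/negP => /existsP[y /andP[/eqP dy lty]].
set z := phi x in dy lty.
have yP : edge_on (dx z) (P (ix y)) by rewrite -(edge_on_opp plane) -dy xP.
have yP' : edge_on (opp (dx z)) (P (ix y)) by rewrite (edge_on_opp plane).
have zP : edge_on (opp (dx z)) (P (ix z)) := oxP z.
have lt : wt (ix y) (dx z) < wt (ix z) (dx z).
  by have := rev_wt zP yP' lty; rewrite oppK.
have kyz : key (mk yP) < key z by rewrite key_same.
move: kyz; rewrite /z /phi; case: (cycsuccP tl key (alf x)) => [tz kz mz|tz kz mz];
  rewrite -/(phi x) -/z in tz kz mz * => kyz; last first.
  by have := mz (mk yP) tz; rewrite leqNgt kyz.
have : key (mk yP) <= key (alf x).
  by rewrite leqNgt; apply/negP => /(mz (mk yP) tz); rewrite leqNgt kyz.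
rewrite leq_eqVlt => /orP[/eqP|/key_rpos] h.
  have e := key_inj (tz : tl (mk yP) = _) h.
  have dzx : dx z = opp (dx x) by rewrite -[LHS]/(dx (mk yP)) e.
  by case/negP: nx; apply/existsP; exists z; rewrite dzx eqxx; move: kz;
    rewrite key_same.
have h2 := key_rpos kz.
have dzx : dx z = opp (dx x).
  by apply: (rpos_inj plane); [exact: tz | apply/eqP; rewrite eqn_leq h].
by case/negP: nx; apply/existsP; exists z; rewrite dzx eqxx; move: kz;
  rewrite key_same.
Qed.

(** * Faces of the original map and faces of its multiplied copy *)

Let used : {set D} := dx @: [set: X].

Let usedP d : reflect (exists i, edge_on d (P i)) (d \in used).
Proof.
apply: (iffP imsetP) => [[x _ ->]|[i h]]; first by exists (ix x); apply: xP.
by exists (mk h).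
Qed.

Let used_opp d : (opp d \in used) = (d \in used).
Proof.
by apply/usedP/usedP => -[i h]; exists i; move: h; rewrite (edge_on_opp plane).
Qed.

Let fp : {perm D} := facep oppK (pe_rot_inj plane) (~: used).

Let fp_used d : d \in used -> fp d = rot (opp d).
Proof. by move=> du; rewrite facepE /keep !inE used_opp du. Qed.

Let fp_unused d : d \notin used -> fp d = rot d.
Proof. by move=> du; rewrite facepE /keep !inE du. Qed.

Let phi_face x : ~~ dig x -> porbit fp (dx (phi x)) = porbit fp (dx x).
Proof.
move=> nx; set z := phi x; set a := opp (dx x).
have ux : dx x \in used by apply/usedP; exists (ix x); apply: xP.
have tza : tail (dx z) = tail a by rewrite -[LHS]/(tl z) [LHS]tl_cycsucc.
set k := findex rot (rot a) (dx z).
have tra : tail (rot a) = tail (dx z) by rewrite (pe_tail_rot plane).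
have ltk : k < fingraph.order rot a.
  have -> : fingraph.order rot a = fingraph.order rot (rot a).
    by apply: (order_tail plane); rewrite (pe_tail_rot plane).
  by apply: findex_max; apply: (pe_fconnect plane).
have ez : iter k rot (rot a) = dx z by apply: iter_findex;
  apply: (pe_fconnect plane).
have between m : m < k -> iter m rot (rot a) \notin used.
  move=> ltm; apply/negP => /usedP[l lP].
  set w := iter m rot (rot a) in lP.
  have wE : w = iter m.+1 rot a by rewrite iterSr.
  have ltm1 : m.+1 < fingraph.order rot a by apply: leq_ltn_trans ltk.
  have fw : findex rot a w = m.+1 by rewrite wE findex_iter.
  have tw : tail w = tail a.
    by rewrite wE; elim: (m.+1) => //= n IHn; rewrite (pe_tail_rot plane).
  have fwE := findex_rpos plane (esym tw).
  have nwa : rpos w != rpos a.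
    by apply/eqP => /(rpos_inj plane tw) e; move: fw; rewrite e findex0.
  have zE : dx z != a -> k.+1 = findex rot a (dx z).
    by move=> ne; rewrite -(findex_rot plane) // -tza.
  have zE2 := findex_rpos plane (esym tza).
  have oa := rpos_lt plane a.
  have ow : rpos w < fingraph.order rot a
    by rewrite -(order_tail plane tw) (rpos_lt plane).
  have oz : rpos (dx z) < fingraph.order rot a
    by rewrite -(order_tail plane tza) (rpos_lt plane).
  rewrite fwE in fw.
  case: (cycsuccP tl key (alf x)) => [tz kz mz|tz kz mz];
    rewrite -/(phi x) -/z in tz kz mz *.
    have rz := key_rpos kz; rewrite -/a in rz.
    have nza : dx z != a.
      apply: contraNneq nx => e; apply/existsP; exists z; rewrite e eqxx /=.
      by move: kz; rewrite key_same // e.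
    have nza' : rpos (dx z) != rpos a.
      by apply: contraNneq nza => /(rpos_inj plane tza) ->.
    rewrite -zE // in zE2.
    have lw : rpos a < rpos w < rpos (dx z).
      move: zE2 fw rz nza' nwa oa ow oz ltm.
      by case: ifP; case: ifP; clear; lia.
    have /andP[lw1 lw2] := lw.
    have := mz (mk lP) tw (rpos_key (lw1 : rpos (dx (alf x)) < rpos (dx (mk lP)))).
    by rewrite leqNgt (rpos_key (lw2 : rpos (dx (mk lP)) < rpos (dx z))).
  have rw : rpos w <= rpos a.
    rewrite leqNgt; apply/negP => h.
    have := kz (mk lP) tw; rewrite leqNgt.
    by rewrite (rpos_key (h : rpos (dx (alf x)) < rpos (dx (mk lP)))).
  have rw2 : rpos (dx z) <= rpos w.
    rewrite leqNgt; apply/negP => h.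
    have := mz (mk lP) tw; rewrite leqNgt.
    by rewrite (rpos_key (h : rpos (dx (mk lP)) < rpos (dx z))).
  have nza : dx z != a.
    by apply: contraNneq nwa => e; move: rw rw2; rewrite e eqn_leq => -> ->.
  have nza' : rpos (dx z) != rpos a.
    by apply: contraNneq nza => /(rpos_inj plane tza) ->.
  rewrite -zE // in zE2; move: zE2 fw rw rw2 nwa nza' ltm oa.
  by case: ifP; case: ifP; clear; lia.
have orb m : m <= k -> porbit fp (iter m rot (rot a)) = porbit fp (dx x).
  elim: m => [_|m IHm ltm] /=; first by rewrite -fp_used // porbit_step.
  by rewrite -fp_unused ?between // porbit_step IHm // ltnW.
by rewrite -ez orb.
Qed.

Variable Ch : {set D}.
Hypothesis ch_opp : forall d, (opp d \in Ch) = (d \in Ch).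
Hypothesis ch_two : forall d, d \in Ch -> #|[set i | edge_on d (P i)]| = 2.
Hypothesis ch_uniq : forall d d', d \in Ch -> d' \in Ch ->
  [set i | edge_on d (P i)] = [set i | edge_on d' (P i)] -> d' = d \/ d' = opp d.

(** On a chosen edge, [eps] exchanges the two sides of the digon between its two copies, so that the
    walk [psi] changes paths there. *)
Let eps (x : X) : X := if dig x && (dx x \in Ch) then phi x else x.

Let epsK : involutive eps.
Proof.
move=> x; rewrite /eps; case E: (dig x && (dx x \in Ch)); last by rewrite E.
case/andP: E => gx dc; have [gz pz] := phi_dig gx; have [dz _ _] := phi_digE gx.
by rewrite gz dz ch_opp dc.
Qed.

Let epsp : {perm X} := perm (inv_inj epsK).
Let moved : {set X} := [set x | eps x != x].

Let phi_ix x : dig x -> ix (phi x) != ix x.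
Proof.
by move=> /phi_digE[_ lt _]; apply: contraTneq lt => ->; rewrite ltnn.
Qed.

Let movedE x : (x \in moved) = dig x && (dx x \in Ch).
Proof.
rewrite inE /eps; case E: (_ && _); last by rewrite eqxx.
by case/andP: E => /phi_ix nx _; apply: contraNneq nx => ->.
Qed.

Let moved_eps x : x \in moved -> eps x = phi x.
Proof. by rewrite movedE /eps => ->. Qed.

Let th (x : X) : X := pif (alf x).
Let psi : {perm X} := (epsp * alp * pip)%g.

Let faces_le : 3 * ncyc psi <= 3 * #|I| + #|moved|.
Proof.
apply: (@ncyc_faces _ _ ix th eps) => //.
- by move=> x; rewrite !permM !permE.
- move=> x y e; have yP : edge_on (dx y) (P (ix x)) by rewrite e xP.
  have [k ek] := around_path plane (gP (ix x)) (xP x) yP.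
  exists k; have h n : ix (iter n th x) = ix x /\
      dx (iter n th x) = iter n (fun d => other (P (ix x)) (opp d)) (dx x).
    elim: n => //= n [IH1 IH2]; split; first by rewrite -IH1.
    by rewrite -IH2 -[in RHS]IH1.
  by apply: xext; case: (h k) => h1 h2; rewrite ?h1 ?h2.
- by move=> x xm; rewrite moved_eps //; move: xm; rewrite movedE => /andP[/phi_ix].
move=> x y xm ym; rewrite !moved_eps // => e1 e2.
move: (xm) (ym); rewrite !movedE => /andP[gx cx] /andP[gy cy].
have [dz lz _] := phi_digE gx; have [dw lw _] := phi_digE gy.
have users (u : X) : dig u -> dx u \in Ch ->
    [set i | edge_on (dx u) (P i)] = [set ix u; ix (phi u)].
  move=> gu cu; have [du _ _] := phi_digE gu.
  apply/esym/eqP; rewrite eqEcard (ch_two cu) cards2 eq_sym (phi_ix gu) andbT.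
  apply/subsetP => i; rewrite !inE => /orP[] /eqP ->; first exact: xP.
  by rewrite -(edge_on_opp plane) -du xP.
have eu : [set i | edge_on (dx x) (P i)] = [set i | edge_on (dx y) (P i)].
  by rewrite !users // -e1 -e2 setUC.
(* Two contacts of the same two paths lie on one edge. In the same direction they would order the
   two paths both ways on one dart. *)
case: (ch_uniq cx cy eu) => ed.
  by move: lz lw; rewrite -e1 -e2 ed; clear; lia.
by right; apply: xext; rewrite ?dz.
Qed.

Let s : {perm X} := (epsp * alp * sg)%g.

Let sE x : s x = phi (eps x).
Proof. by rewrite !permM !permE. Qed.

(** On an unchosen digon [s] is [phi]; on a chosen one [eps] is [phi], which cancels and leaves both
    sides fixed by [s]. *)
Let s_dig x : dig x -> dig (s x) /\ s (s x) = x.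
Proof.
move=> gx; have [gz pz] := phi_dig gx; have [dz _ _] := phi_digE gx.
rewrite !sE /eps gx /=; case: ifP => cx; first by rewrite pz gx cx pz.
by rewrite gz dz ch_opp cx pz.
Qed.

Let s_nodig x : ~~ dig x -> s x = phi x.
Proof. by move=> nx; rewrite sE /eps (negPf nx). Qed.

Let A : {set X} := [set x | dig x].

Let dig_label (x : X) := if dig x then None else Some (porbit fp (dx x)).

Let dig_labelP x y : porbit s x = porbit s y -> dig_label x = dig_label y.
Proof.
move/eqP; rewrite eq_porbit_mem; apply: porbit_invariant => z.
rewrite /dig_label; have [gz|nz] := boolP (dig z); first by case: (s_dig gz) => ->.
by rewrite s_nodig // (negPf (phi_nodig nz)) phi_face.
Qed.

Let last_at d : d \in used -> exists2 x, ~~ dig x & dx x = d.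
Proof.
case/usedP => i0 h0.
case: (arg_maxnP (P := fun i => edge_on d (P i)) (fun i => wt i (opp d)) h0) => i iP mi.
exists (mk iP) => //; apply/negP => /existsP[y /andP[/eqP dy]].
rewrite ltnNge => /negP; apply; apply: mi.
by rewrite -(edge_on_opp plane) -[X in Defs.edge_on _ X _]dy xP.
Qed.

(** For each used dart exactly one copy is not a digon side: the one that comes last on the reversed
    dart. *)
Let card_nodig : #|~: A| = #|used|.
Proof.
have -> : used = dx @: ~: A.
  apply/setP => d; apply/idP/imsetP => [/last_at[x nx <-]|[x _ ->]].
    by exists x; rewrite // !inE.
  by apply/usedP; exists (ix x); apply: xP.
rewrite card_in_imset // => x y; rewrite !inE => nx ny e; apply: xext => //.
apply: (@wt_inj _ _ (opp (dx x))); rewrite ?oxP //; first by rewrite e oxP.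
have [lt|lt|//] := ltngtP (wt (ix x) (opp (dx x))) (wt (ix y) (opp (dx x))).
  by case/existsP: nx; exists (alf y);
    rewrite /= -[dx (alf y)]/(opp (dx y)) -e eqxx.
by case/existsP: ny; exists (alf x); rewrite -[dx (alf x)]/(opp (dx x)) e eqxx -e.
Qed.

(** On digon sides [s] is an involution that fixes every moved copy, so [leq_card_involution] counts
    its cycles there. The remaining cycles map onto the faces of the used subgraph. *)
Let ncyc_s_ge : #|A| + #|moved| + 2 * #|porbit fp @: used| <= 2 * ncyc s.
Proof.
have c1 : #|A| + #|moved| <= 2 * #|porbit s @: A|.
  apply: leq_trans (leq_card_involution (s := s) (A := A) _ _).
  - rewrite leq_add2l; apply: subset_leq_card; apply/subsetP => x xm.
    rewrite inE sE moved_eps //; move: xm; rewrite movedE inE => /andP[gx _].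
    by rewrite gx; case: (phi_dig gx) => _ ->; rewrite eqxx.
  - by move=> x; rewrite !inE => /s_dig[].
  - by move=> x; rewrite inE => /s_dig[].
have c2 : #|porbit fp @: used| <= #|porbit s @: ~: A|.
  apply: leq_trans (_ : #|(fun x => porbit fp (dx x)) @: ~: A| <= _).
    apply: subset_leq_card; apply/subsetP => _ /imsetP[d /last_at[x nx <-] ->].
    by apply/imsetP; exists x; rewrite // !inE.
  apply: leq_card_imset_factor => x y; rewrite !inE => nx ny /dig_labelP.
  by rewrite /dig_label (negPf nx) (negPf ny) => -[].
have dis : [disjoint porbit s @: A & porbit s @: ~: A].
  apply/pred0P => O /=; apply/negbTE/negP => /andP[/imsetP[x xA ->] /imsetP[y yA]].
  move/dig_labelP; rewrite /dig_label; move: xA yA; rewrite !inE => ->.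
  by move/negPf ->.
have c3 : #|porbit s @: A| + #|porbit s @: ~: A| <= ncyc s.
  have [_ /esym] := leq_card_setU (porbit s @: A) (porbit s @: ~: A).
  rewrite dis => /esym/eqP <-; apply: subset_leq_card.
  by rewrite subUset; apply/andP; split; apply/subsetP => O /imsetP[x _ ->];
    apply: imset_f.
move: c1 c2 c3; set a := #|A|; set m := #|moved|; set f := #|porbit fp @: used|.
by set b := #|porbit s @: A|; set c := #|porbit s @: ~: A|; clear; lia.
Qed.

Let card_fixed : #|[set x | pip x == x]| <= 2 * #|I|.
Proof.
rewrite -sum1dep_card (partition_big ix predT) //= mulnC -sum_nat_const.
apply: leq_sum => i _; rewrite sum1dep_card.
apply: leq_trans (card_path_ends plane (gP i)).
have inj : {in [set x | (pip x == x) && (ix x == i)] &, injective dx}.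
  move=> x y; rewrite !inE => /andP[_ /eqP ex] /andP[_ /eqP ey] e.
  by apply: xext => //; rewrite ex ey.
rewrite -(card_in_imset inj); apply: subset_leq_card; apply/subsetP => d.
case/imsetP=> x; rewrite !inE permE => /andP[/eqP ex /eqP <-] ->.
by apply/andP; split; [exact: xP | apply/eqP; exact: (congr1 dx ex)].
Qed.

(** Write [N], [m], [n] for the numbers of copies, moved copies and paths. The estimates for [s] and
    [pip * sg] sum to [2 * (cs + ck) >= 2 * N + m - 2 * n], so [ncycM_ge] yields
    [m <= 2 * ncyc psi + 2 * n]. Together with [3 * ncyc psi <= 3 * n + m] this gives
    [m <= 12 * n]. *)
Lemma contacts_le : #|Ch| <= 12 * #|I|.
Proof.
(* Of the two users of a chosen dart, the one that is first on the reversed dart has a digon side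
   there. *)
have chm : #|Ch| <= #|moved|.
  apply: leq_trans (leq_imset_card dx _); apply: subset_leq_card.
  apply/subsetP => d dc; have /eqP/cards2P[i [j [nij eij]]] := ch_two dc.
  have di : edge_on d (P i) by have : i \in [set i; j] by [rewrite !inE eqxx];
    rewrite -eij inE.
  have dj : edge_on d (P j) by have : j \in [set i; j] by [rewrite !inE eqxx orbT];
    rewrite -eij inE.
  have oi : edge_on (opp d) (P i) by rewrite (edge_on_opp plane).
  have oj : edge_on (opp d) (P j) by rewrite (edge_on_opp plane).
  have [lt|lt|/wt_inj e] := ltngtP (wt i (opp d)) (wt j (opp d)).
  - apply/imsetP; exists (mk di) => //; rewrite movedE dc andbT.
    by apply/existsP; exists (mk oj); rewrite eqxx.
  - apply/imsetP; exists (mk dj) => //; rewrite movedE dc andbT.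
    by apply/existsP; exists (mk oi); rewrite eqxx.
  - by rewrite e ?eqxx in nij.
have piK x : pip (pip x) = x by rewrite !permE pifK.
have tl_pi x : tl (pip x) = tl x by rewrite permE; apply: tail_other.
have regions := ncyc_regions key_inj piK tl_pi noncrossing.
have chords := card_chords key_inj piK tl_pi.
have psiE : psi = (s * (pip * sg)^-1)%g.
  rewrite invMg mulgA /s mulgK; congr (_ * _)%g.
  by apply/permP => x; apply: (@perm_inj _ pip); rewrite permKV piK.
have := ncyc_div_ge s (pip * sg)%g; rewrite -psiE => tri.
have tlU : #|tl @: [set: X]| = #|tail @: used|.
  by rewrite /used -imset_comp.
have eul := euler_used plane used_opp; rewrite -/fp in eul.
have cA : #|A| + #|used| = #|X| by rewrite -card_nodig cardsC.
move: chm regions chords tri tlU eul cA faces_le ncyc_s_ge card_fixed.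
set cs := ncyc s; set ck := ncyc (pip * sg)%g; set cp := ncyc psi.
set n := #|I|; set m := #|moved|; set N := #|X|; set a := #|A|; set u := #|used|.
set v := #|tl @: _|; set v' := #|tail @: used|; set f := #|porbit fp @: used|.
set tp := #|[set x | key (pip x) < key x]|; set fx := #|[set x | pip x == x]|.
clear; lia.
Qed.

End Contacts.

(** * Random sampling *)

Lemma leq_card_bigcup (T J : finType) (Q : pred J) (F : J -> {set T}) :
  #|\bigcup_(j | Q j) F j| <= \sum_(j | Q j) #|F j|.
Proof.
elim/big_ind2: _ => [|a A b B leA leB|//]; first by rewrite cards0.
have [le _] := leq_card_setU A B; apply: leq_trans le _; exact: leq_add.
Qed.

Section Sampling.
Variables (I : finType) (k : nat).
Hypothesis k0 : 0 < k.
Variables (E : {set {set I}}) (conf : {set I} -> {set I}).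
Hypothesis E2 : forall B, B \in E -> #|B| = 2.
Hypothesis conf_le : forall B, B \in E -> #|conf B| <= 5 * k.
Hypothesis conf_dis : forall B l, B \in E -> l \in conf B -> l \notin B.
Hypothesis sparse : forall Z : {set I},
  #|[set B in E | (B \subset Z) && [disjoint conf B & Z]]| <= 12 * #|Z|.

(** For a uniformly random [f], the sample [zs f] contains each index independently with probability
    [1/M]. Probabilities appear as numbers of functions out of [M ^ #|I|]. *)
Let M := (10 * k).+1.
Let zs (f : {ffun I -> 'I_M}) := [set i | f i == ord0].

Let card_zs (J : {set I}) :
  #|[set f | J \subset zs f]| * M ^ #|J| = M ^ #|I|.
Proof.
have -> : #|[set f | J \subset zs f]| = #|pffun_on (ord0 : 'I_M) (~: J) predT|.
  apply: eq_card => f; rewrite inE; apply/idP/pffun_onP => [sub|[/supportP h _]].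
    split=> //; apply/supportP => i; rewrite inE negbK => iJ.
    by have := subsetP sub _ iJ; rewrite inE => /eqP.
  by apply/subsetP => i iJ; rewrite inE h // inE negbK.
by rewrite card_pffun_on card_ord -expnD addnC cardsC.
Qed.

Let sum_zs : (\sum_f #|zs f|) * M = #|I| * M ^ #|I|.
Proof.
have -> : \sum_f #|zs f| = \sum_(i : I) #|[set f | [set i] \subset zs f]|.
  under eq_bigr => f _ do rewrite -sum1dep_card big_mkcond /=.
  rewrite exchange_big /=; apply: eq_bigr => i _.
  rewrite -sum1dep_card [RHS]big_mkcond /=; apply: eq_bigr => f _.
  by rewrite sub1set inE.
rewrite big_distrl /= -sum_nat_const; apply: eq_bigr => i _.
by rewrite -(card_zs [set i]) cards1 expn1.
Qed.

Let good (B : {set I}) := [set f | (B \subset zs f) && [disjoint conf B & zs f]].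

(** Union bound: [B] is sampled with probability [M^-2], and together with a given conflict with
    probability [M^-3]. At most [5 * k] conflicts leave [(M - 5 * k) * M^-3], and [M - 5 * k]
    exceeds [5 * k]. *)
Let good_ge B : B \in E -> 5 * k * M ^ #|I| <= #|good B| * M ^ 3.
Proof.
move=> BE; set N := M ^ #|I|.
have sub : [set f | B \subset zs f] \subset
    good B :|: \bigcup_(l in conf B) [set f | l |: B \subset zs f].
  apply/subsetP => f; rewrite !inE => Bf; rewrite Bf /=.
  have [//|/pred0Pn[l /= /andP[lc lz]]] := boolP [disjoint conf B & zs f].
  by apply/bigcupP; exists l => //; rewrite inE subUset sub1set lz.
have cB : #|[set f | B \subset zs f]| * M ^ 2 = N by rewrite /N -(card_zs B) E2.
have cl : (\sum_(l in conf B) #|[set f | l |: B \subset zs f]|) * M ^ 3 = #|conf B| * N.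
  rewrite big_distrl /= -sum_nat_const; apply: eq_bigr => l lc.
  by rewrite /N -(card_zs (l |: B)) cardsU1 (conf_dis BE lc) E2.
have [le1 _] := leq_card_setU (good B) (\bigcup_(l in conf B) [set f | l |: B \subset zs f]).
have le2 := leq_card_bigcup (fun l => l \in conf B) (fun l => [set f | l |: B \subset zs f]).
have le : #|[set f | B \subset zs f]| <=
    #|good B| + \sum_(l in conf B) #|[set f | l |: B \subset zs f]|.
  apply: leq_trans (subset_leq_card sub) (leq_trans le1 _).
  by rewrite leq_add2l.
have le3 : N * M <= #|good B| * M ^ 3 + #|conf B| * N.
  rewrite -cl -mulnDl -{1}cB -mulnA -expnSr.
  by apply: leq_mul.
have le4 : #|conf B| * N <= 5 * k * N by apply: leq_mul (conf_le BE) _.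
have le5 : N * M = 5 * k * N + 5 * k * N + N.
  by rewrite /M mulnS (mulnC N) (_ : 10 * k = 5 * k + 5 * k) ?mulnDl; lia.
move: le3 le4 le5; set a := #|good B| * _; set b := #|conf B| * _.
set c := 5 * k * N; set d := N * M; clear; lia.
Qed.

(** Count the surviving pairs over all samples in two ways; a sample has [#|I| / M] elements on
    average. This gives [5 * k * #|E| <= 12 * #|I| * M^2], and [M <= 11 * k] yields the factor
    [1452 / 5 < 291]. *)
Lemma sampling_bound : #|E| <= 291 * (k * #|I|).
Proof.
have dc : \sum_f #|[set B in E | (B \subset zs f) && [disjoint conf B & zs f]]| =
    \sum_(B in E) #|good B|.
  under eq_bigr => f _ do rewrite -sum1dep_card.
  rewrite (exchange_big_dep (fun B => B \in E)) /=; last by move=> f B _ /andP[].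
  apply: eq_bigr => B BE; rewrite -sum1dep_card; apply: eq_bigl => f.
  by rewrite BE.
have N0 : 0 < M ^ #|I| by rewrite expn_gt0.
have up : (\sum_(B in E) #|good B|) * M <= 12 * (#|I| * M ^ #|I|).
  rewrite -dc -sum_zs mulnA leq_mul2r; apply/orP; right.
  by rewrite big_distrr /=; apply: leq_sum.
have lo : #|E| * (5 * k * M ^ #|I|) <= (\sum_(B in E) #|good B|) * M ^ 3.
  by rewrite -sum_nat_const big_distrl /=; apply: leq_sum => B; apply: good_ge.
have : #|E| * (5 * k) * M ^ #|I| <= 12 * #|I| * M ^ 2 * M ^ #|I|.
  rewrite -mulnA; apply: leq_trans lo _.
  rewrite (expnS M 2) mulnA; apply: leq_trans (leq_mul up (leqnn _)) _.
  by rewrite -!mulnA (mulnC (M ^ #|I|)) -mulnn -!mulnA.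
rewrite leq_pmul2r // => le.
have leM : M ^ 2 <= 121 * k ^ 2.
  have leM1 : M <= 11 * k by rewrite /M; lia.
  by apply: leq_trans (leq_mul leM1 leM1) _; nia.
have : #|E| * (5 * k) <= 12 * #|I| * (121 * k ^ 2).
  by apply: leq_trans le _; apply: leq_mul.
have -> : 12 * #|I| * (121 * k ^ 2) = (1452 * (k * #|I|)) * k by nia.
rewrite mulnA leq_pmul2r //; move: (k * #|I|) => x; clear; lia.
Qed.

End Sampling.

(** * Degeneracy and colouring *)

Section Degree.
Variables (V D : finType) (tail : D -> V) (opp rot : D -> D).
Hypothesis plane : plane_embedding tail opp rot.
Notation is_gpath := (is_gpath tail opp).
Notation edge_on := (edge_on opp).
Notation other := (other_dart tail opp).

Variables (I : finType) (P : I -> gpath V D) (k : nat).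
Hypothesis k0 : 0 < k.
Hypothesis gP : forall i, is_gpath (P i).
Hypothesis unc : forall i j, i != j -> uncrossed tail opp rot (P i) (P j).
Hypothesis ple : forall d, #|[set i | edge_on d (P i)]| <= k.

Let users d := [set i | edge_on d (P i)].
Let ends i := [set d | edge_on d (P i) && (other (P i) d == d)].
Let nb i := (\bigcup_(d in ends i) users d) :\ i.
(** One shared dart is fixed for each pair, so that a pair contributes a single contact edge. *)
Let sh (B : {set I}) : option D := [pick d | B \subset users d].
Let usersB B := if sh B is Some d then users d else set0.
(* If a sample contains the pair [B] but nothing from [conf B], then the pair is
   alone on the edge [sh B] and its end edges are private. *)
Let conf (B : {set I}) := ((\bigcup_(i in B) nb i) :|: usersB B) :\: B.
Let E := [set B : {set I} | (#|B| == 2) && [exists d, B \subset users d]].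
(** Pairs in which one path uses an end edge of the other. Sampling cannot make these end edges
    private, so such pairs are counted directly. *)
Let Eb := [set B in E | [exists i in B, ~~ [disjoint nb i & B]]].
Let Eg := E :\: Eb.

Let card_nb i : #|nb i| <= 2 * k.
Proof.
apply: leq_trans (subset_leq_card (subD1set _ _)) _.
apply: leq_trans (leq_card_bigcup _ _) _.
apply: leq_trans (_ : \sum_(d in ends i) k <= _).
  by apply: leq_sum => d _; apply: ple.
by rewrite sum_nat_const leq_mul2r (card_path_ends plane) ?orbT.
Qed.

(** Two paths with two end edges each account for [4 * k] users, the shared edge for [k] more. *)
Let card_conf B : B \in Eg -> #|conf B| <= 5 * k.
Proof.
rewrite !inE => /and3P[_ /eqP B2 _].
apply: leq_trans (subset_leq_card (subsetDl _ _)) _.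
have [le _] := leq_card_setU (\bigcup_(i in B) nb i) (usersB B).
apply: leq_trans le _.
have le1 : #|\bigcup_(i in B) nb i| <= 2 * (2 * k).
  apply: leq_trans (leq_card_bigcup _ _) _.
  apply: leq_trans (_ : \sum_(i in B) 2 * k <= _).
    by apply: leq_sum => i _; apply: card_nb.
  by rewrite sum_nat_const B2.
have le2 : #|usersB B| <= k by rewrite /usersB; case: (sh B) => [d|];
  rewrite ?cards0 ?ple.
by apply: leq_trans (leq_add le1 le2) _; clear; lia.
Qed.

Let card_Eb : #|Eb| <= 2 * k * #|I|.
Proof.
pose W := \bigcup_(i : I) ((fun j => [set i; j]) @: nb i).
apply: leq_trans (_ : #|W| <= _).
  apply: subset_leq_card; apply/subsetP => B; rewrite !inE.
  case/andP=> /andP[/cards2P[a [b [nab eB]]] _] /existsP[i /andP[iB]].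
  case/pred0Pn=> j /= /andP[jn jB].
  have nij : j != i by move: jn; rewrite !inE => /andP[].
  apply/bigcupP; exists i => //; apply/imsetP; exists j => //.
  apply/esym/eqP; rewrite eqEcard subUset !sub1set iB jB /= eB !cards2 nab.
  by rewrite eq_sym nij.
apply: leq_trans (leq_card_bigcup _ _) _.
apply: leq_trans (_ : \sum_(i : I) 2 * k <= _); last by rewrite sum_nat_const mulnC.
by apply: leq_sum => i _; apply: leq_trans (leq_imset_card _ _) _.
Qed.

(** A surviving pair lies in [A], the members of [Z] whose end edges carry no other member of [Z].
    This family satisfies the privacy hypothesis of [contacts_le], and the darts [sh B] supply its
    contacts. *)
Let sparse (Z : {set I}) :
  #|[set B in Eg | (B \subset Z) && [disjoint conf B & Z]]| <= 12 * #|Z|.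
Proof.
set G := [set B in Eg | _].
pose A := [set i in Z | [disjoint nb i & Z]].
have GE B : B \in G -> [/\ #|B| = 2, B \subset Z, [disjoint conf B & Z]
    & exists2 d, sh B = Some d & B \subset users d].
  rewrite !inE => /andP[/and3P[_ /eqP B2 /existsP[d hd]] /andP[BZ cZ]]; split=> //.
  by rewrite /sh; case: pickP => [d' hd'|/(_ d)]; [exists d' | rewrite hd].
have GA B : B \in G -> B \subset A.
  move=> BG; have [_ BZ cZ _] := GE B BG; apply/subsetP => i iB.
  rewrite inE (subsetP BZ) //=; apply/pred0P => l /=;
    apply/negbTE/negP => /andP[ln lZ].
  (* As [conf B] omits [B] itself, a conflict within the pair is excluded by [B] not being in
     [Eb]. *)
  have [lB|nlB] := boolP (l \in B).
    move: BG; rewrite !inE => /andP[/andP[nEb EB] _]; case/negP: nEb.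
    rewrite EB /=; apply/existsP; exists i; rewrite iB /=.
    by apply/pred0Pn; exists l; rewrite /= ln lB.
  have lc : l \in conf B.
    rewrite inE nlB inE; apply/orP; left; apply/bigcupP; by exists i.
  by have := disjointFr cZ lc; rewrite lZ.
pose J : finType := {i : I | i \in A}.
pose Q (i : J) := P (val i).
have gQ i : is_gpath (Q i) by apply: gP.
have uncQ i j : i != j -> uncrossed tail opp rot (Q i) (Q j).
  by move=> nij; apply: unc; rewrite (inj_eq val_inj).
have privQ (i j : J) d : edge_on d (Q i) -> other (Q i) d = d -> edge_on d (Q j) -> j = i.
  move=> di oi dj; apply: val_inj; apply/eqP; apply: contraT => nij.
  have := valP i; rewrite inE => /andP[_ dis].
  have := valP j; rewrite inE => /andP[jZ _].
  have jn : val j \in nb (val i).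
    rewrite !inE nij; apply/bigcupP; exists d; last by rewrite inE.
    by rewrite inE; apply/andP; split; [|apply/eqP].
  by have := disjointFr dis jn; rewrite jZ.
pose Ch := [set d | [exists B in G, (sh B == Some d) || (sh B == Some (opp d))]].
have ChP d : d \in Ch -> exists2 B, B \in G & sh B = Some d \/ sh B = Some (opp d).
  rewrite inE => /existsP[B /andP[BG /orP[]/eqP e]]; exists B => //; first by left.
  by right.
have oppK := pe_oppK plane.
have uE d B : B \in G -> sh B = Some d \/ sh B = Some (opp d) ->
    [set i | edge_on d (Q i)] = [set i : J | val i \in B].
  move=> BG hd; have [_ BZ cZ [d' sB Bu]] := GE B BG.
  have dd' x : edge_on d (P x) = (x \in users d').
    rewrite inE; case: hd; rewrite sB => -[->] //; by rewrite (edge_on_opp plane).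
  apply/setP => i; rewrite !inE dd'; apply/idP/idP => [iu|iB];
    last exact: (subsetP Bu).
  apply: contraT => niB; have ic : val i \in conf B.
    by rewrite inE niB inE /usersB sB iu orbT.
  have := valP i; rewrite inE => /andP[iZ _].
  by have := disjointFr cZ ic; rewrite iZ.
have valB B : B \in G -> val @: [set i : J | val i \in B] = B.
  move=> BG; apply/setP => x; apply/imsetP/idP => [[i]|xB].
    by rewrite inE => iB ->.
  have xA := subsetP (GA B BG) _ xB.
  by exists (exist _ x xA : J); rewrite // inE.
have ch_opp d : (opp d \in Ch) = (d \in Ch).
  by rewrite !inE; apply: eq_existsb => B; rewrite oppK orbC.
have ch_two d : d \in Ch -> #|[set i | edge_on d (Q i)]| = 2.
  case/ChP => B BG hB; rewrite (uE _ _ BG hB).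
  have [<- _ _ _] := GE B BG.
  by rewrite -{2}(valB B BG) card_imset //; apply: val_inj.
have ch_uniq d d' : d \in Ch -> d' \in Ch ->
    [set i | edge_on d (Q i)] = [set i | edge_on d' (Q i)] -> d' = d \/ d' = opp d.
  case/ChP=> B BG hB /ChP[B' BG' hB']; rewrite (uE _ _ BG hB) (uE _ _ BG' hB') => e.
  have eB : B = B' by rewrite -(valB B BG) e valB.
  rewrite -eB in hB'; case: hB => h; case: hB'; rewrite h => -[e'].
  - by left.
  - by right; rewrite e' oppK.
  - by right.
  - by left; apply/esym/(inv_inj oppK).
have := contacts_le plane gQ uncQ privQ ch_opp ch_two ch_uniq.
have cJ : #|J| <= #|Z|.
  rewrite card_sig; apply: subset_leq_card; apply/subsetP => i.
  by rewrite !inE => /andP[].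
have GCh : #|G| <= #|Ch|.
  rewrite -(card_imset Ch (f := @Some D)); last by move=> ? ? [].
  rewrite -(card_in_imset (f := sh) (D := G)); last first.
    move=> B B' BG BG' e; have [_ _ _ [d sB _]] := GE B BG.
    rewrite -(valB B BG) -(valB B' BG') -(uE d B BG) ?(uE d B' BG') //; left => //.
    by rewrite -e.
  apply: subset_leq_card; apply/subsetP => _ /imsetP[B BG ->].
  have [_ _ _ [d sB _]] := GE B BG; rewrite sB; apply: imset_f; rewrite inE.
  by apply/existsP; exists B; rewrite BG sB eqxx.
by move: cJ GCh; set a := #|J|; set b := #|Z|; set c := #|G|; set e := #|Ch|;
  clear; lia.
Qed.

Let card_E : #|E| <= 293 * (k * #|I|).
Proof.
have EgE B : B \in Eg -> #|B| = 2 by rewrite !inE => /and3P[_ /eqP].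
have conf_dis B l : B \in Eg -> l \in conf B -> l \notin B.
  by move=> _; rewrite inE => /andP[].
have := sampling_bound k0 EgE card_conf conf_dis sparse.
have sub : Eb \subset E by apply/subsetP => B; rewrite inE => /andP[].
have := cardsID Eb E; rewrite (setIidPr sub) -/Eg.
move: card_Eb; rewrite -mulnA; set a := #|Eb|; set b := #|Eg|; set c := #|E|.
by set m := k * _; clear; lia.
Qed.

(** By [card_E], where [293 = 291 + 2] adds the pairs of [Eb], the average degree is at most
    [2 * 293 * k]. *)
Lemma low_degree : 0 < #|I| ->
  exists i, #|[set j | (i != j) && [exists d, edge_on d (P i) && edge_on d (P j)]]|
            <= 586 * k.
Proof.
move=> n0; pose deg i := #|[set B in E | i \in B]|.
have sum_deg : \sum_i deg i = 2 * #|E|.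
  rewrite /deg; under eq_bigr => i _ do rewrite -sum1dep_card.
  rewrite (exchange_big_dep (fun B => B \in E)) /=; last by move=> i B _ /andP[].
  rewrite mulnC -sum_nat_const; apply: eq_bigr => B BE.
  have : #|B| = 2 by move: BE; rewrite inE => /andP[/eqP].
  by rewrite -sum1_card => <-; apply: eq_bigl => i; rewrite BE.
have [i di] : exists i, deg i <= 586 * k.
  apply/existsP; apply: contraT => /existsPn h.
  have : \sum_(i : I) (586 * k).+1 <= \sum_i deg i.
    by apply: leq_sum => i _; rewrite ltnNge h.
  rewrite sum_deg sum_nat_const; move: card_E n0.
  rewrite mulnS [#|I| * (586 * k)]mulnC -[586 * k * _]mulnA; set m := k * _;
    set n := #|I|; set e := #|E|.
  by clear; lia.
exists i; apply: leq_trans di.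
rewrite -(card_in_imset (f := fun j => [set i; j])); last first.
  move=> j j'; rewrite !inE => /andP[nij _] _ e.
  have : j \in [set i; j'] by rewrite -e !inE eqxx orbT.
  by rewrite !inE eq_sym (negPf nij) => /eqP.
apply: subset_leq_card; apply/subsetP => B /imsetP[j].
rewrite inE => /andP[nij /existsP[d /andP[di dj]]] ->.
rewrite !inE eqxx /= andbT cards2 nij /=; apply/existsP; exists d.
by rewrite subUset !sub1set !inE di.
Qed.

End Degree.

(** * Greedy colouring of degenerate graphs *)

Section Greedy.
Variables (T : finType) (adj : rel T) (m : nat).
Hypothesis adj_sym : symmetric adj.
Hypothesis adj_irr : irreflexive adj.
Hypothesis m0 : 0 < m.
Hypothesis degenerate : forall S : {set T}, S != set0 ->
  exists2 x, x \in S & #|[set y in S | adj x y]| < m.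

(** Set aside a vertex with fewer than [m] neighbours in [S], colour the rest, and give it a colour
    that these neighbours miss. *)
Lemma greedy_coloring (S : {set T}) :
  exists f : {ffun T -> 'I_m}, {in S &, forall x y, adj x y -> f x != f y}.
Proof.
have [n] := ubnP #|S|; elim: n S => // n IHn S ltS.
have [->|S0] := eqVneq S set0.
  by exists [ffun=> Ordinal m0] => x y; rewrite inE.
have [x xS dx] := degenerate S0.
have [|f fP] := IHn (S :\ x); first by move: ltS; rewrite (cardsD1 x) xS.
pose used := f @: [set y in S | adj x y].
have [c cN] : exists c, c \notin used.
  apply/existsP; apply: contraT => /existsPn h.
  have : #|[set: 'I_m]| <= #|used|.
    by apply: subset_leq_card; apply/subsetP => c _; rewrite -[_ \in _]negbK h.
  rewrite cardsT card_ord => h1; have := leq_trans h1 (leq_imset_card _ _).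
  by rewrite leqNgt dx.
exists [ffun y => if y == x then c else f y] => y z yS zS ayz; rewrite !ffunE.
have ny : y != z by apply: contraTneq ayz => ->; rewrite adj_irr.
case: (eqVneq y x) => [ey|nyx]; case: (eqVneq z x) => [ez|nzx].
- by rewrite ey ez eqxx in ny.
- apply: contraNneq cN => ->; apply: imset_f; by rewrite inE zS -ey.
- apply: contraNneq cN => <-; apply: imset_f; by rewrite inE yS adj_sym -ez.
by apply: fP => //; rewrite !inE ?nyx ?nzx.
Qed.

Lemma chi_le_degenerate : chi adj <= m.
Proof.
have [f fP] := greedy_coloring [set: T].
have cm : colorableb adj m.
  apply/existsP; exists f; apply/forallP => x; apply/forallP => y; apply/implyP.
  by apply: fP; rewrite inE.
(* If [m] lies outside the list searched by [chi], the length [#|T|.+1] of that list already bounds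
   the result. *)
rewrite /chi; have [ltm|gem] := ltnP m #|T|.+1; last first.
  by apply: leq_trans (find_size _ _) _; rewrite size_iota.
rewrite leqNgt; apply/negP => /(before_find 0).
by rewrite nth_iota // add0n cm.
Qed.

End Greedy.

Theorem theoremC1 :
  exists c : nat,
  forall (V D : finType) (tail : D -> V) (opp rot : D -> D),
    plane_embedding tail opp rot ->
  forall (k n : nat) (P : 'I_n -> gpath V D),
    0 < k ->
    injective P ->
    (forall i, is_gpath tail opp (P i)) ->
    (forall i j, i != j -> uncrossed tail opp rot (P i) (P j)) ->
    (forall d : D, #|[set i | edge_on opp d (P i)]| <= k) ->
    chi (adjU opp P) <= c * k ^ 2 * (trunc_log 2 (nedges (adjU opp P))).+1.
Proof.
exists 587 => V D tail opp rot plane k n P k0 _ gP unc ple.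
(* Greedy colouring needs one colour more than the degree [586 * k]. As [k >= 1], this is at most
   [587 * k ^ 2], and the logarithmic factor is at least one. *)
apply: (@leq_trans (586 * k).+1); last first.
  have le1 : (586 * k).+1 <= 587 * k ^ 2 by nia.
  by apply: leq_trans le1 _; rewrite mulnS leq_addr.
apply: chi_le_degenerate => //.
- move=> i j; rewrite /adjU eq_sym; congr (_ && _).
  by apply: eq_existsb => d; rewrite andbC.
- by move=> i; rewrite /adjU eqxx.
(* Every subfamily inherits the hypotheses, so [low_degree] gives a vertex of small degree in each
   induced subgraph. *)
move=> S S0; pose J : finType := {i : 'I_n | i \in S}.
pose Q (i : J) := P (val i).
have gQ i : is_gpath tail opp (Q i) by apply: gP.
have uncQ i j : i != j -> uncrossed tail opp rot (Q i) (Q j).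
  by move=> nij; apply: unc; rewrite (inj_eq val_inj).
have pleQ d : #|[set i | edge_on opp d (Q i)]| <= k.
  apply: leq_trans (ple d); rewrite -(card_imset _ val_inj).
  by apply: subset_leq_card; apply/subsetP => _ /imsetP[i + ->]; rewrite !inE.
have J0 : 0 < #|J| by rewrite card_sig card_gt0.
have [i di] := low_degree plane k0 gQ uncQ pleQ J0.
exists (val i); first exact: (valP i).
rewrite ltnS; apply: leq_trans di; rewrite -[X in _ <= X](card_imset _ val_inj).
apply: subset_leq_card; apply/subsetP => j; rewrite inE => /andP[jS adj_ij].
apply/imsetP; exists (exist _ j jS : J) => //.
by move: adj_ij; rewrite inE /adjU -(inj_eq val_inj).
Qed.
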